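(* Let $p$ be a positive integer and $k,m$ integers; let $C\in\mathbb C\setminus\{0\}$ and $D,S,E\in\mathbb C$. If $k\ge m+2$, then there is an exact sequence (of $F(k,p)$-modules) of the form $$0\to \mathrm M_k(m+p)\xrightarrow{\ \iota\ }\mathrm M_k(m)\xrightarrow{\ \pi\ }\mathrm M_k(m+1)\to0,$$ with the morphisms uniquely determined by $\iota(v_{k,m+p})=a(-m-1)v_{k,m}$ and $\pi(v_{k,m})=v_{k,m+1}$. It may be seen as a grading-preserving exact sequence $$0\to \mathrm M_k(m+p;S+C,E+m+D)\to \mathrm M_k(m;S,E)\to \mathrm M_k(m+1;S,E)\to0$$ among bigraded $F(k,p;C,D)$-modules.
   Context: All vector spaces are over $\mathbb C$; vertex superalgebras are also called vertex algebras. For a positive integer $p$, $F(p)$ is the free vertex algebra generated by one element $a$ (even if $p$ is even, odd if $p$ is odd) with $(z-w)^{-p}Y(a,z)Y(a,w)=(w-z)^{-p}Y(a,w)Y(a,z)$, powers being expanded in non-negative powers of the second variable; it is the initial object among vertex algebras generated by such an $a$ (with the $\mathbb Z$-grading for which $a$ has degree $1$). Write $Y(a,z)=\sum_{n\in\mathbb Z}a(n)z^{-n-1}$. For an integer $k$, $F(k,p)$ is the quotient vertex algebra $F(k,p)=F(p)/\sum_{n\ge0}a(-k-n)F(p)$; the image of $a$ is again denoted $a$. For an integer $m$, $\mathrm M_k(m)$ is the free representation of order $-m$ over $F(k,p)$: the universal $F(k,p)$-module generated by a vector $v_{k,m}$ with $a(-m+n)v_{k,m}=0$ for all integers $n\ge0$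 (if a module is generated by a vector satisfying the same condition, there is a unique surjection from $\mathrm M_k(m)$ onto it sending $v_{k,m}$ to that vector). Bigradings: $F(k,p;C,D)$ is $F(k,p)$ with $a(-n_r)\cdots a(-n_1)\mathbf 1$ in bidegree $(Cr,\ n_1+\cdots+n_r-r+rD)$; $\mathrm M_k(m;S,E)$ is $\mathrm M_k(m)$ with $a(-n_r)\cdots a(-n_1)v_{k,m}$ in bidegree $(S+Cr,\ E+n_1+\cdots+n_r-r+rD)$. Homomorphisms are understood up to identification of equivalent (shifted) charge/parity gradings.
   Formalization: The claim is proved for m ≥ 0 only: for m < 0 the operator a(-m-1) acts by zero on every F(k,p)-module, so ι = 0 while M_k(m+p) is nonzero, and the sequence is not exact. *)

(* Defs.v *)
From mathcomp Require Import all_boot all_order all_algebra.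
Set Implicit Arguments.
Unset Strict Implicit.
Unset Printing Implicit Defensive.
Import Order.TTheory GRing.Theory Num.Theory.
Local Open Scope ring_scope.

(* The binomial coefficient of an arbitrary integer, using
   binom(-(i+1), j) = (-1)^j binom(i+j, j) on negative arguments. *)
Definition binz (x : int) (j : nat) : int :=
  match x with
  | Posz i => 'C(i, j)%:Z
  | Negz i => (-1) ^+ j * 'C(i + j, j)%:Z
  end.

(* The infinite sums below have finitely many nonzero terms, because of the
   truncation axiom, so that two of them are equal exactly when their partial
   sums eventually coincide. *)
Definition series_eq (V : zmodType) (f g : nat -> V) : Prop :=
  exists N0 : nat, forall N : nat, (N0 <= N)%N ->
    \sum_(j < N) f j = \sum_(j < N) g j.

Section Linear.
Variables (K : fieldType) (V : lmodType K).

Definition subspace (P : V -> Prop) : Prop :=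
  P 0 /\ forall (c : K) (u v : V), P u -> P v -> P (c *: u + v).

Definition spanned (X : V -> Prop) (u : V) : Prop :=
  forall P : V -> Prop, subspace P -> (forall x, X x -> P x) -> P u.

(* V is the direct sum of the subspaces G i *)
Definition is_grading (I : eqType) (G : I -> V -> Prop) : Prop :=
  [/\ forall i, subspace (G i),
      forall v, exists (s : seq I) (f : I -> V),
        (forall i, G i (f i)) /\ v = \sum_(i <- s) f i
    & forall (s : seq I) (f : I -> V), uniq s -> (forall i, G i (f i)) ->
        \sum_(i <- s) f i = 0 -> forall i, i \in s -> f i = 0].

End Linear.

(* [act u n x] is u_(n) x; parities are booleans, [true] being odd.
   Y(1,z) = id is [act_vac], and [act_borcherds] is the Borcherds identity
     sum_j binom(m,j) (u_(n+j) v)_(l+m-j)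
       = sum_j (-1)^j binom(n,j)
           (u_(m+n-j) v_(l+j) - (-1)^(n + |u||v|) v_(n+l-j) u_(m+j)). *)
Record is_representation (K : fieldType) (V M : lmodType K)
    (parV : bool -> V -> Prop) (vac : V) (mul : V -> int -> V -> V)
    (parM : bool -> M -> Prop) (act : V -> int -> M -> M) : Prop :=
  IsRepresentation {
    act_linear_l : forall n x, linear (fun u => act u n x);
    act_linear_r : forall u n, linear (act u n);
    act_parity : forall s t u n x,
      parV s u -> parM t x -> parM (s (+) t) (act u n x);
    act_truncation : forall u x, exists N : int,
      forall n : int, N <= n -> act u n x = 0;
    act_vac : forall n x, act vac n x = if n == -1 then x else 0;
    act_borcherds : forall (s t : bool) (u v : V) (x : M) (l m n : int),
      parV s u -> parV t v ->
      series_eq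
        (fun j : nat => act (mul u (n + j%:Z) v) (l + m - j%:Z) x *~ binz m j)
        (fun j : nat =>
           (act u (m + n - j%:Z) (act v (l + j%:Z) x)
            - (-1) ^+ (`|n|%N + (s && t)) *:
                act v (n + l - j%:Z) (act u (m + j%:Z) x))
           *~ ((-1) ^+ j * binz n j))
  }.

Record vertexAlg (K : fieldType) : Type := VertexAlg {
  va_sort :> lmodType K;
  va_par : bool -> va_sort -> Prop;
  va_vac : va_sort;
  va_mode : va_sort -> int -> va_sort -> va_sort;
  va_par_grading : is_grading va_par;
  va_vac_even : va_par false va_vac;
  va_adjoint : is_representation va_par va_vac va_mode va_par va_mode;
  va_creation : forall u, va_mode u (-1) va_vac = u;
  va_creation0 : forall u (n : int), 0 <= n -> va_mode u n va_vac = 0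
}.

Record vmodule (K : fieldType) (V : vertexAlg K) : Type := VModule {
  vm_sort :> lmodType K;
  vm_par : bool -> vm_sort -> Prop;
  vm_act : V -> int -> vm_sort -> vm_sort;
  vm_par_grading : is_grading vm_par;
  vm_representation :
    is_representation (@va_par K V) (@va_vac K V) (@va_mode K V) vm_par vm_act
}.

Arguments va_par {K} v _ _.
Arguments va_vac {K} v.
Arguments va_mode {K} v _ _ _.
Arguments vm_par {K V} v _ _.
Arguments vm_act {K V} v _ _ _.

Section VertexAlgebras.
Variable K : fieldType.

Definition va_hom (V W : vertexAlg K) (f : V -> W) : Prop :=
  [/\ linear f,
      f (va_vac V) = va_vac W,
      forall u n v, f (va_mode V u n v) = va_mode W (f u) n (f v)
    & forall s u, va_par V s u -> va_par W s (f u)].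

Definition va_generated (V : vertexAlg K) (a : V) : Prop :=
  forall P : V -> Prop, subspace P -> P (va_vac V) -> P a ->
    (forall u n v, P u -> P v -> P (va_mode V u n v)) -> forall v, P v.

(* The coefficient of z^(-i-1) w^(-j-1) in
     (z-w)^(-p) Y(a,z) Y(a,w) = (w-z)^(-p) Y(a,w) Y(a,z),
   where (z-w)^(-p) = sum_(r >= 0) (-1)^r binom(-p,r) z^(-p-r) w^r. *)
Definition va_locality (p : nat) (V : vertexAlg K) (a : V) : Prop :=
  forall (i j : int) (x : V),
    series_eq
      (fun r : nat =>
         va_mode V a (i - p%:Z - r%:Z) (va_mode V a (j + r%:Z) x)
         *~ ((-1) ^+ r * binz (- p%:Z) r))
      (fun r : nat =>
         va_mode V a (j - p%:Z - r%:Z) (va_mode V a (i + r%:Z) x)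
         *~ ((-1) ^+ r * binz (- p%:Z) r)).

Definition locally_generated (p : nat) (V : vertexAlg K) (a : V) : Prop :=
  [/\ va_par V (odd p) a, va_locality p a & va_generated a].

(* (V, a) is the free vertex algebra F(p), as an initial object *)
Definition is_free_va (p : nat) (V : vertexAlg K) (a : V) : Prop :=
  locally_generated p a /\
  forall (W : vertexAlg K) (b : W), locally_generated p b ->
    exists f : V -> W,
      [/\ va_hom f, f a = b
        & forall g : V -> W, va_hom g -> g a = b -> g =1 f].

(* q : F -> Q exhibits Q as the quotient vertex algebra
   F / sum_(n >= 0) a(-k-n) F *)
Definition is_quotient_va (k : int) (F : vertexAlg K) (a : F)
    (Q : vertexAlg K) (q : F -> Q) : Prop :=
  [/\ va_hom q,
      forall y, exists x, q x = y
    & forall x, q x = 0 <-> exists (N : nat) (f : nat -> F),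
        x = \sum_(n < N) va_mode F a (- k - (n : nat)%:Z) (f n)].

End VertexAlgebras.

Section Modules.
Variables (K : fieldType) (V : vertexAlg K).

(* Parity-homogeneous morphisms of either parity: a parity shift of a module
   keeps the action, so odd morphisms commute with the action without sign. *)
Definition vm_hom (M W : vmodule V) (f : M -> W) : Prop :=
  [/\ linear f,
      forall u n x, f (vm_act M u n x) = vm_act W u n (f x)
    & exists e : bool, forall s x, vm_par M s x -> vm_par W (e (+) s) (f x)].

Definition unique_vm_hom (M W : vmodule V) (v : M) (w : W) (f : M -> W) : Prop :=
  [/\ vm_hom f, f v = w
    & forall g : M -> W, vm_hom g -> g v = w -> g =1 f].

Definition vm_generated (M : vmodule V) (v : M) : Prop :=
  forall P : M -> Prop, subspace P -> P v ->
    (forall u n x, P x -> P (vm_act M u n x)) -> forall x, P x.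

Definition rep_of_order (a : V) (m : int) (M : vmodule V) (v : M) : Prop :=
  [/\ exists s, vm_par M s v,
      forall n : int, 0 <= n -> vm_act M a (- m + n) v = 0
    & vm_generated v].

(* (M, v) is the free representation of order -m of V, relative to a *)
Definition is_free_rep (a : V) (m : int) (M : vmodule V) (v : M) : Prop :=
  rep_of_order a m v /\
  forall (W : vmodule V) (w : W), rep_of_order a m w ->
    exists f : M -> W, unique_vm_hom v w f /\ forall y, exists x, f x = y.

Definition short_exact (A B C : lmodType K) (f : A -> B) (g : B -> C) : Prop :=
  [/\ injective f, forall y, g y = 0 <-> exists x, f x = y
    & forall z, exists y, g y = z].

(* The subspace of bidegree cd: the span of the a(-n_r) ... a(-n_1) v with
   cd = (S + C r, E + n_1 + ... + n_r - r + r D); the sequence ns lists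
   n_r, ..., n_1 in this order. *)
Definition bidegree (M : lmodType K) (act : V -> int -> M -> M) (a : V) (v : M)
    (C D S E : K) (cd : K * K) : M -> Prop :=
  spanned (fun x => exists ns : seq int,
    [/\ x = foldr (fun n => act a (- n)) v ns,
        cd.1 = S + C * (size ns)%:R
      & cd.2 = E + (\sum_(n <- ns) n)%:~R - (size ns)%:R + (size ns)%:R * D]).

Definition va_bidegree (a : V) (C D : K) : K * K -> V -> Prop :=
  bidegree (va_mode V) a (va_vac V) C D 0 0.

Definition vm_bidegree (M : vmodule V) (a : V) (v : M) (C D S E : K) :
    K * K -> M -> Prop :=
  bidegree (vm_act M) a v C D S E.

Definition is_bigraded (M : lmodType K) (act : V -> int -> M -> M)
    (GV : K * K -> V -> Prop) (GM : K * K -> M -> Prop) : Prop :=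
  is_grading GM /\
  forall (b c : K * K) (u : V) (n : int) (x : M), GV b u -> GM c x ->
    GM (b.1 + c.1, b.2 + c.2 - n%:~R - 1) (act u n x).

Definition is_bigraded_va (GV : K * K -> V -> Prop) : Prop :=
  GV (0, 0) (va_vac V) /\ is_bigraded (va_mode V) GV GV.

Definition is_bigraded_vm (GV : K * K -> V -> Prop) (M : vmodule V)
    (GM : K * K -> M -> Prop) : Prop :=
  is_bigraded (vm_act M) GV GM.

End Modules.

(* Main.v *)
From HB Require Import structures.
Require Import Defs.
From mathcomp Require Import all_boot all_order all_algebra.
From mathcomp Require Import boolp functions reals complex.
From mathcomp Require Import zify ring.
Set Implicit Arguments.
Unset Strict Implicit.
Unset Printing Implicit Defensive.
Import Order.TTheory GRing.Theory Num.Theory.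
Local Open Scope ring_scope.
Local Open Scope complex_scope.

(** The proof replaces vertex algebra modules by modules over a commutative
or exterior-like algebra of finitely many operators.

In F(p) all products a_(n) a with n >= - p vanish. Since p > 0 the modes of a
therefore supercommute, and in the quotient F(k,p) only the modes
x_i = a_(-1-i) with 0 <= i < k - 1 can be non-zero on any module. Put
a(z) = sum_i x_i z^i. The only remaining relation is that a(z) a(w) is
divisible by (z - w)^p, and M_k(m) is the algebra generated by the x_i with
this relation, modulo x_0, ..., x_(m-1). The sequence of the theorem is then
multiplication by x_m followed by reduction modulo x_m. Everything except the
injectivity of iota and the inclusion ker pi <= im iota is formal.

Those two points follow from a basis of M_k(m). A word w = (w_0, ..., w_(r-1))
stands for the monomial x_(w_0) ... x_(w_(r-1)) v, and the basis words are those
with letters between m and k - 2 that decrease by steps of at least p. They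
span because the Borcherds identity rewrites x_i x_j, for i < j + p, as a
combination of products x_(i+s) x_(j-s) with s > 0 (lemma straighten); this
lowers the weight sum_t t w_t (lemma word_act_straighten). Given the basis,
iota appends the letter m, so it maps basis words with letters at least m + p
to basis words with letters at least m, and pi keeps precisely the basis words
that are not of this form. Hence the sequence is exact (lemmas iota_injective
and kernel_pi).

Independence needs modules on which the monomials can be told apart. A linear
form on the part of degree r in the x_i is an array f of coefficients, indexed
by words of length r, of a polynomial f(z_1, ..., z_r); the relations say that
f is symmetric up to the sign (-1)^p and vanishes to order p where two
variables coincide. For a basis word l with l_t = nu_t + (p - 1) (r - 1 - t),
the polynomial det(z_i ^ nu_j) det(z_i ^ (r - 1 - j)) ^ (p - 1) has these properties,
takes the value 1 at l, and all its other monomials have larger weight than l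
(lemmas detector_leading_word and detector_symmetric). So the matrix that pairs
basis words with these polynomials is unitriangular (lemma
triangular_separation).

To make such linear forms available on M_k(m), which is only known through its
universal property, all arrays satisfying the relations are collected into a
space on which x_i acts by reading off a last letter (section WordSpace). It
becomes an F(k,p)-module as follows. A series of supercommuting operators with
the relations above generates, under products and divided derivatives, a
supercommutative algebra of series; this is a vertex algebra without
non-negative modes, and it acts on the space (lemmas comm_representation and
operator_vertex_algebra). The universal property of F(p) maps F(p) to it, and
the map factors through F(k,p) (lemma quotient_va_factor). Applied to the
submodule generated by one array, the universal property of M_k(m) yields the
linear form (lemma free_rep_detected). The same linear forms show that the
bidegrees are gradings, both for the M_k(m) and for F(k,p), which is treated as
the module generated by its vacuum. *)

(** * Linear maps and subspaces given by predicates *)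
Section LinearMaps.
Variables (K : fieldType) (U V : lmodType K) (f : U -> V).
Hypothesis linf : linear f.

Let fL : {linear U -> V} := HB.pack f (GRing.isLinear.Build K U V *:%R f linf).

Lemma lin0 : f 0 = 0. Proof. exact: (raddf0 fL). Qed.
Lemma linD x y : f (x + y) = f x + f y. Proof. exact: (raddfD fL). Qed.
Lemma linB x y : f (x - y) = f x - f y. Proof. exact: (raddfB fL). Qed.
Lemma linMz n x : f (x *~ n) = f x *~ n. Proof. exact: (raddfMz fL). Qed.
Lemma linMn n x : f (x *+ n) = f x *+ n. Proof. exact: (raddfMn fL). Qed.
Lemma linZ c x : f (c *: x) = c *: f x. Proof. exact: (linearZ_LR fL). Qed.
Lemma lin_sum I (r : seq I) (P : pred I) F :
  f (\sum_(i <- r | P i) F i) = \sum_(i <- r | P i) f (F i).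
Proof. exact: (raddf_sum fL). Qed.

End LinearMaps.

Section Subspaces.
Variables (K : fieldType) (V : lmodType K).
Implicit Types P : V -> Prop.

Lemma subspaceD P u v : subspace P -> P u -> P v -> P (u + v).
Proof. by move=> [_ sP] Pu Pv; rewrite -[u]scale1r; apply: sP. Qed.
Lemma subspaceZ P c u : subspace P -> P u -> P (c *: u).
Proof. by move=> [P0 sP] Pu; rewrite -[_ *: _]addr0; apply: sP. Qed.
Lemma subspaceN P u : subspace P -> P u -> P (- u).
Proof. by move=> sP Pu; rewrite -scaleN1r; apply: subspaceZ. Qed.
Lemma subspaceB P u v : subspace P -> P u -> P v -> P (u - v).
Proof. by move=> sP Pu Pv; apply: subspaceD => //; apply: subspaceN. Qed.
Lemma subspaceMn P n u : subspace P -> P u -> P (u *+ n).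
Proof. by move=> sP Pu; rewrite -scaler_nat; apply: subspaceZ. Qed.
Lemma subspaceMz P (n : int) u : subspace P -> P u -> P (u *~ n).
Proof. by move=> sP Pu; rewrite -scaler_int; apply: subspaceZ. Qed.
Lemma subspace_sum P I (r : seq I) (Q : pred I) (F : I -> V) : subspace P ->
  (forall i, Q i -> P (F i)) -> P (\sum_(i <- r | Q i) F i).
Proof.
move=> sP PF; elim/big_ind: _ => //; first by case: sP.
by move=> x y Px Py; apply: subspaceD.
Qed.

Lemma spanned_subspace (X : V -> Prop) : subspace (spanned X).
Proof.
split=> [P sP _|c u v Xu Xv P sP PX]; first by case: sP.
by case: (sP) => _; apply; [apply: Xu | apply: Xv].
Qed.
Lemma spanned_gen (X : V -> Prop) x : X x -> spanned X x.
Proof. by move=> Xx P _; apply. Qed.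

Lemma subspace_preim (U : lmodType K) (f : U -> V) P :
  linear f -> subspace P -> subspace (fun x => P (f x)).
Proof.
move=> linf sP; split=> [|c u v Pu Pv]; first by rewrite lin0 //; case: sP.
by rewrite linf; case: sP => _; apply.
Qed.

Lemma subspace_eq0 : subspace (fun v : V => v = 0).
Proof. by split=> // c u v -> ->; rewrite scaler0 addr0. Qed.

Lemma subspace_forall I (P : I -> V -> Prop) :
  (forall i, subspace (P i)) -> subspace (fun v => forall i, P i v).
Proof.
move=> sP; split=> [i|c u v Pu Pv i]; first by case: (sP i).
by case: (sP i) => _; apply.
Qed.

Lemma subspace_and P P' : subspace P -> subspace P' ->
  subspace (fun v => P v /\ P' v).
Proof.
move=> [P0 sP] [P'0 sP']; split=> // c u v [Pu P'u] [Pv P'v].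
by split; [apply: sP | apply: sP'].
Qed.

Lemma subspace_eq (U : lmodType K) (f g : V -> U) :
  linear f -> linear g -> subspace (fun x => f x = g x).
Proof.
move=> lf lg; split=> [|c u v fu fv]; first by rewrite !lin0.
by rewrite lf lg fu fv.
Qed.

Lemma is_grading_bool (G : bool -> V -> Prop) :
  (forall s, subspace (G s)) ->
  (forall v, exists v0 v1, [/\ G false v0, G true v1 & v = v0 + v1]) ->
  (forall v, G false v -> G true v -> v = 0) ->
  is_grading G.
Proof.
move=> sG dG iG; split=> // [v|s f us Gf sf0 i si].
  have [v0 [v1 [Gv0 Gv1 ->]]] := dG v.
  exists [:: false; true], (fun b => if b then v1 else v0).
  by split; [case | rewrite !big_cons big_nil addr0].
move: sf0; rewrite (bigD1_seq i) //= => sf0.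
have Gi : G (~~ i) (f i).
  have/eqP := sf0; rewrite addr_eq0 => /eqP ->.
  apply: subspaceN => //; apply: (subspace_sum _ (sG _)) => j ji.
  by have <- : j = ~~ i by move: ji; clear; case: i; case: j.
have Gfi := Gf i; clear si sf0; case: i Gi Gfi => Gi Gfi; exact: iG.
Qed.

Lemma grading_bool_decomp (G : bool -> V -> Prop) v : is_grading G ->
  exists v0 v1, [/\ G false v0, G true v1 & v = v0 + v1].
Proof.
move=> [sG dG _]; have [s [f [Gf ->]]] := dG v.
exists (\sum_(i <- s | ~~ i) f i), (\sum_(i <- s | i) f i).
split; last by rewrite addrC (bigID id).
  by apply: (subspace_sum _ (sG _)) => -[] //= _; apply: Gf.
by apply: (subspace_sum _ (sG _)) => -[] //= _; apply: Gf.
Qed.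

Lemma grading_bool_disjoint (G : bool -> V -> Prop) v : is_grading G ->
  G false v -> G true v -> v = 0.
Proof.
move=> [sG _ iG] G0 G1.
apply: (iG [:: false; true] (fun b => if b then - v else v) _ _ _ false) => //.
  by case=> //; apply: subspaceN.
by rewrite !big_cons big_nil addr0 subrr.
Qed.

End Subspaces.

Section SubType.
Variables (K : fieldType) (V : lmodType K) (P : V -> Prop).
Hypothesis sP : subspace P.

(** Carrying the stability proof as an index lets unification find the closure
of the predicate, and with it the module structure of the subtype below. *)
Definition subspace_pred of subspace P : {pred V} := fun v => `[< P v >].

Lemma subspace_predP v : reflect (P v) (v \in subspace_pred sP).
Proof. exact: asboolP. Qed.

Fact subspace_pred_closed : submod_closed (subspace_pred sP).
Proof.
split=> [|c u v /subspace_predP Pu /subspace_predP Pv]; apply/subspace_predP.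
  by case: sP.
by case: sP => _; apply.
Qed.
HB.instance Definition _ :=
  GRing.isSubmodClosed.Build K V (subspace_pred sP) subspace_pred_closed.

Definition subspace_sort := {v : V | v \in subspace_pred sP}.
HB.instance Definition _ := Choice.on subspace_sort.
HB.instance Definition _ := SubType.on subspace_sort.
HB.instance Definition _ := [SubChoice_isSubLmodule of subspace_sort by <:].

Definition subspace_in v (Pv : P v) : subspace_sort :=
  exist _ v (introT (subspace_predP v) Pv).

Lemma subspace_valP (v : subspace_sort) : P (\val v).
Proof. exact/subspace_predP/(valP v). Qed.
Lemma subspace_val_linear : linear (\val : subspace_sort -> V).
Proof. exact: linearP. Qed.

End SubType.

(** * The Borcherds identity for commuting fields without poles *)
Section Binomials.

Lemma binz0 x : binz x 0 = 1.
Proof. by case: x => i /=; rewrite bin0 ?mulr1 ?expr0. Qed.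

Lemma binzS x j : binz (x + 1) j.+1 = binz x j.+1 + binz x j.
Proof.
case: x => [i|[|i]].
- by have -> : Posz i + 1 = Posz i.+1 by lia; rewrite /= binS PoszD.
- by rewrite /= !add0n !binn bin0n exprS /=; ring.
have -> : Negz i.+1 + 1 = Negz i by lia.
rewrite /= (_ : i.+1 + j.+1 = (i + j.+1).+1)%N; last by lia.
rewrite binS PoszD (_ : i.+1 + j = i + j.+1)%N; last by lia.
by rewrite exprS; ring.
Qed.

Lemma binz_Vandermonde (x : int) (n N : nat) :
  \sum_(j < N.+1) binz x j * 'C(n, N - j)%:Z = binz (x + n%:Z) N.
Proof.
elim: n N => [|n IHn] N.
  rewrite addr0 big_ord_recr /= subnn bin0 mulr1 big1 ?add0r // => j _.
  by rewrite bin0n (_ : (N - j == 0)%N = false) ?mulr0 //; have := ltn_ord j; lia.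
case: N => [|N].
  by rewrite big_ord_recl big_ord0 /= subn0 bin0 !binz0 mulr1 addr0.
rewrite (_ : x + n.+1%:Z = (x + n%:Z) + 1); last by lia.
rewrite binzS -!IHn [LHS]big_ord_recr [X in _ = X + _]big_ord_recr /=.
rewrite !subnn !bin0 addrAC; congr (_ + _).
rewrite -big_split; apply: eq_bigr => j _ /=.
by rewrite (subSn (leq_ord j)) binS PoszD mulrDr.
Qed.

End Binomials.

(** A field without poles: its mode of index - 1 - i is the coefficient of
z^i, which is written op u i. *)
Definition modes (T U W : Type) (z : W) (op : T -> nat -> U -> W)
    (u : T) (n : int) (x : U) : W :=
  if n is Negz i then op u i x else z.

(** Each side of the Borcherds identity is a sum over its own index j; this
sorts the terms by the mode they contain, so that the two sides can be compared
coefficient by coefficient. *)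
Lemma sum_pick (V : zmodType) (S N : nat) (G : int -> V) (phi : nat -> int)
    (c : nat -> int) :
  (forall z : int, ~~ (0 <= z < S%:Z) -> G z = 0) ->
  \sum_(j < N) G (phi j) *~ c j =
  \sum_(i < S) G i%:Z *~ (\sum_(0 <= j < N | phi j == i%:Z) c j).
Proof.
move=> G0; under [RHS]eq_bigr => i _ do rewrite big_mkord mulrz_sumr big_mkcond /=.
rewrite exchange_big /=; apply: eq_bigr => j _.
have [/andP[]|out] := boolP (0 <= phi j < S%:Z).
  case: (phi j) => // z _; rewrite ltz_nat => zS.
  rewrite (bigD1 (Ordinal zS)) //= eqxx big1 ?addr0 // => i /eqP iz.
  by case: eqP => // -[zi]; case: iz; apply: val_inj.
rewrite (G0 _ out) mul0rz big1 // => i _.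
case: eqP => // ij; case/negP: out; rewrite ij.
by have := ltn_ord i; lia.
Qed.

Lemma sum_ord_eventually0 (V : zmodType) (F : nat -> V) A N : (A <= N)%N ->
  (forall j, (A <= j < N)%N -> F j = 0) -> \sum_(j < N) F j = \sum_(j < A) F j.
Proof.
move=> AN F0; rewrite -!(big_mkord xpredT F) (big_cat_nat (leq0n A)) //=.
by rewrite [X in _ + X]big_nat_cond [X in _ + X]big1 ?addr0 // => j /andP[/F0].
Qed.

Lemma sum_ord_pred1 (R : nmodType) (N i0 : nat) (P : pred nat) (c : nat -> R) :
  (forall j, P j = (j == i0)) ->
  \sum_(0 <= j < N | P j) c j = if (i0 < N)%N then c i0 else 0.
Proof.
move=> PE; rewrite big_mkord; under eq_bigl => j do rewrite PE.
case: ltnP => iN; first by rewrite (big_pred1 (Ordinal iN)).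
by rewrite big1 // => j /eqP jE; have := ltn_ord j; lia.
Qed.

Lemma sum_ord_pred0 (R : nmodType) (N : nat) (P : pred nat) (c : nat -> R) :
  (forall j, P j = false) -> \sum_(0 <= j < N | P j) c j = 0.
Proof. by move=> PN; rewrite big1 // => j; rewrite PN. Qed.

(** For commuting fields the right side of the Borcherds identity pairs
u(z) v(w) z^m with the difference of the two expansions of (z - w)^n. They
agree for n >= 0. For n = - 1 - N0 the difference is, up to sign, the N0-th
divided derivative of the delta function, and pairing z^(m+i) with it gives a
binomial coefficient. *)
Lemma delta_coefficient (n m : int) (i N : nat) : (`|m| + i + `|n| + 1 < N)%N ->
  \sum_(0 <= j < N | - 1 - m - n + j%:Z == i%:Z) (-1) ^+ j * binz n j
  - (-1) ^+ `|n|%N * \sum_(0 <= j < N | - 1 - m - j%:Z == i%:Z) (-1) ^+ j * binz n j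
  = if n is Negz N0 then binz (m + i%:Z) N0 else 0.
Proof.
move=> bound.
case My : (m + i%:Z) => [y|y].
  rewrite [X in _ * X]sum_ord_pred0; last by lia.
  rewrite mulr0 subr0; case: n bound => [n|n] bound.
    rewrite (@sum_ord_pred1 _ _ (y.+1 + n)); last by lia.
    by rewrite ifT; [rewrite /= bin_small ?mulr0 //; lia | lia].
  have [ny|yn] := leqP n y; last first.
    rewrite sum_ord_pred0; last by lia.
    by rewrite /= bin_small.
  rewrite (@sum_ord_pred1 _ _ (y - n)); last by lia.
  rewrite ifT /=; last by lia.
  by rewrite mulrA -exprMn mulrNN mulr1 expr1n mul1r subnKC // bin_sub.
rewrite [X in _ * X](@sum_ord_pred1 _ _ y); last by lia.
rewrite ifT; last by lia.
case: n bound => [n|n] bound.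
  have [yn|ny] := leqP y n; last first.
    rewrite sum_ord_pred0; last by lia.
    by rewrite /= bin_small // !mulr0 subr0.
  rewrite (@sum_ord_pred1 _ _ (n - y)); last by lia.
  rewrite ifT /=; last by lia.
  rewrite bin_sub // mulrA -exprD -(subnK yn) addnK.
  by rewrite -addnA exprD addnn -[in (-1) ^+ y.*2]signr_odd odd_double mulr1 subrr.
rewrite sum_ord_pred0; last by lia.
rewrite sub0r /= exprS mulN1r mulNr opprK; congr (_ * _).
rewrite mulrA -exprMn mulrNN mulr1 expr1n mul1r.
by rewrite -[in RHS](bin_sub (leq_addl y n)) addnK addnC.
Qed.

(** In this section u_i denotes the coefficients of series that supercommute
on M, and comp u i v the product of the i-th divided derivative of u with v,
which in a vertex algebra of this kind is u_(-1-i) v. *)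
Section CommutativeRepresentation.
Variables (K : fieldType) (V M : lmodType K).
Variables (parV : bool -> V -> Prop) (vac : V) (comp : V -> nat -> V -> V).
Variables (parM : bool -> M -> Prop) (act : V -> nat -> M -> M).
Hypothesis parM_subspace : forall s, subspace (parM s).
Hypothesis act_linl : forall i x, linear (fun u => act u i x).
Hypothesis act_linr : forall u i, linear (act u i).
Hypothesis act_par : forall s t u i x,
  parV s u -> parM t x -> parM (s (+) t) (act u i x).
Hypothesis act_vac : forall i x, act vac i x = if i == 0%N then x else 0.
Hypothesis act_comp : forall u i v n x,
  act (comp u i v) n x =
  \sum_(j < (n + i).+1) act u j (act v (n + i - j) x) *+ 'C(j, i).
Hypothesis act_comm : forall s t u v i j x, parV s u -> parV t v ->
  act u i (act v j x) = (-1) ^+ (s && t) *: act v j (act u i x).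

Notation mact := (modes 0 act).
Notation mcomp := (modes 0 comp).

Let mact_linr u n : linear (mact u n).
Proof. by case: n => n; [move=> a x y; rewrite /= scaler0 addr0 | apply: act_linr]. Qed.

Let act_linl' n x : linear (fun u => mact u n x).
Proof.
by case: n => n; [move=> a u v; rewrite /= scaler0 addr0 | apply: act_linl].
Qed.

Let act0 u i : act u i 0 = 0. Proof. exact: lin0 (act_linr u i). Qed.

Let mact0l n x : mact 0 n x = 0. Proof. exact: lin0 (act_linl' n x). Qed.

Let mact0 u n : mact u n 0 = 0. Proof. exact: lin0 (mact_linr u n). Qed.

Let mact_comm s t u v a b x : parV s u -> parV t v ->
  mact v b (mact u a x) = (-1) ^+ (s && t) *: mact u a (mact v b x).
Proof.
move=> us vt; case: b => b; case: a => a; rewrite /= ?act0 ?scaler0 //.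
by rewrite (act_comm _ _ _ vt us) andbC.
Qed.

(** Every term of the Borcherds identity for l, m, n is a multiple of some
u_(-1-z) v_(z-1-S), with S = - 2 - l - m - n fixed. *)
Let pair_coef u v (S : int) x (z : int) := mact u (- 1 - z) (mact v (z - 1 - S) x).

Let pair_coef_out u v S x z : ~~ (0 <= z < S + 1) -> pair_coef u v S x z = 0.
Proof.
rewrite /pair_coef => out; have [z0|z0] := ltrP z 0.
  by case E : (- 1 - z) => [a|a] //; lia.
by case E : (z - 1 - S) => [a|a] /=; rewrite ?mact0 //; lia.
Qed.

(** Both sides are combinations of the finitely many products u_i v_(S-i). On
the left, for n = - 1 - N0, the coefficient is the Vandermonde sum over j of
binom(m, j) binom(i, N0 - j); on the right [delta_coefficient] gives it. *)
Lemma comm_representation : is_representation parV vac mcomp parM mact.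
Proof.
split=> //.
- move=> s t u [] n x us xt /=; last exact: act_par.
  by case: (parM_subspace (s (+) t)).
- by move=> u x; exists 0 => -[].
- by case=> n x //=; rewrite act_vac; case: n.
move=> s t u v x l m n us vt.
set S : int := - 2 - l - m - n.
pose T : nat := if S is Posz k then k.+1 else 0%N.
have G0 z : ~~ (0 <= z < T%:Z) -> pair_coef u v S x z = 0.
  by move=> zT; apply: pair_coef_out; move: zT; rewrite /T; case: (S) => k; lia.
(* Beyond this bound no further term of either side is non-zero. *)
exists (`|m| + T + `|n| + 2)%N => N leN.
(* The common value of both sides, sorted by the index of the mode of u. *)
transitivity (\sum_(i < T) pair_coef u v S x i%:Z *~
   (if n is Negz N0 then binz (m + i%:Z) N0 else 0)).
  case En : n => [n0|N0].
    rewrite [RHS]big1 => [|i _]; last by rewrite mulr0z.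
    by rewrite big1 // => j _; rewrite /= mact0l mul0rz.
  transitivity (\sum_(j < N0.+1)
      (\sum_(i < T) pair_coef u v S x i%:Z *+ 'C(i, N0 - j)) *~ binz m j).
    pose F j := mact (mcomp u (Negz N0 + j%:Z) v) (l + m - j%:Z) x *~ binz m j.
    rewrite (@sum_ord_eventually0 _ F N0.+1); last 2 first.
    - by move: leN; rewrite En; lia.
    - move=> j /andP[jN _]; rewrite /F; have -> : Negz N0 + j%:Z = (j - N0.+1)%:Z by lia.
      by rewrite /= mact0l mul0rz.
    apply: eq_bigr => j _; rewrite /F; congr (_ *~ _).
    have jN := ltn_ord j; have -> : Negz N0 + j%:Z = Negz (N0 - j) by lia.
    rewrite /=; case ES : S => [k|k]; last first.
      rewrite /T ES big_ord0; case E : (l + m - j%:Z) => [a|a] //.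
      by move: ES E; rewrite /S En; lia.
    case E : (l + m - j%:Z) => [a|a] /=; last first.
      have Ea : (a + (N0 - j) = k)%N by move: ES E; rewrite /S En; lia.
      rewrite act_comp Ea /T ES; apply: eq_bigr => i _; congr (_ *+ _).
      have ik := ltn_ord i.
      rewrite /pair_coef (_ : - 1 - i%:Z = Negz i); last by lia.
      by rewrite (_ : i%:Z - 1 - k%:Z = Negz (k - i)) //; lia.
    rewrite big1 // => i _; rewrite bin_small //.
    have TE : T = k.+1 by rewrite /T ES.
    have ik : (i < k.+1)%N by rewrite -TE.
    by move: ES E; rewrite /S En; lia.
  under eq_bigr => j _ do rewrite mulrz_suml.
  rewrite exchange_big /=; apply: eq_bigr => i _.
  rewrite -binz_Vandermonde mulrz_sumr; apply: eq_bigr => j _.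
  by rewrite mulrC mulrzA -pmulrn.
transitivity (\sum_(j < N)
  (pair_coef u v S x (- 1 - m - n + j%:Z) *~ ((-1) ^+ j * binz n j)
   - pair_coef u v S x (- 1 - m - j%:Z) *~ ((-1) ^+ `|n|%N * ((-1) ^+ j * binz n j)))).
  pose c j := (-1) ^+ j * binz n j.
  rewrite sumrB (sum_pick N (fun j => - 1 - m - n + j%:Z) c G0).
  rewrite (sum_pick N (fun j => - 1 - m - j%:Z) (fun j => (-1) ^+ `|n|%N * c j) G0).
  rewrite -sumrB; apply: eq_bigr => i _.
  rewrite -mulrzBr; congr (_ *~ _); rewrite -big_distrr /= delta_coefficient //.
  by have := ltn_ord i; lia.
apply: eq_bigr => j _.
rewrite (mact_comm _ _ _ us vt) scalerA -exprD -addnA addnn exprD.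
have sgn2 e : (-1) ^+ e.*2 = 1 :> K by rewrite -signr_odd odd_double.
rewrite sgn2 mulr1 /pair_coef.
rewrite (_ : - 1 - (- 1 - m - n + j%:Z) = m + n - j%:Z); last by lia.
rewrite (_ : - 1 - m - n + j%:Z - 1 - S = l + j%:Z); last by rewrite /S; lia.
rewrite (_ : - 1 - (- 1 - m - j%:Z) = m + j%:Z); last by lia.
rewrite (_ : - 1 - m - j%:Z - 1 - S = n + l - j%:Z); last by rewrite /S; lia.
rewrite mulrzBl (mulrzA _ ((-1) ^+ `|n|)); congr (_ - _ *~ _).
by rewrite -scaler_int rmorphXn rmorphN1.
Qed.
End CommutativeRepresentation.

(** * Pulling representations back and restricting them *)
Section Transport.
Variable K : fieldType.

Lemma representation_pullback (V W : vertexAlg K) (g : V -> W) (M : lmodType K)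
    (parM : bool -> M -> Prop) (act : W -> int -> M -> M) : va_hom g ->
  is_representation (@va_par K W) (va_vac W) (va_mode W) parM act ->
  is_representation (@va_par K V) (va_vac V) (va_mode V) parM
    (fun u n x => act (g u) n x).
Proof.
move=> [ling gvac gmode gpar] [ll lr par trunc avac borch]; split=> //.
- by move=> n x c u v; rewrite ling ll.
- by move=> s t u n x us; apply: par; apply: gpar.
- by move=> n x; rewrite gvac.
move=> s t u v x l m n us vt.
have [N0 bN] := borch s t _ _ x l m n (gpar _ _ us) (gpar _ _ vt).
exists N0 => N /bN <-; apply: eq_bigr => j _; by rewrite gmode.
Qed.

Lemma representation_restrict (V : vertexAlg K) (M N : lmodType K)
    (parM : bool -> M -> Prop) (actM : V -> int -> M -> M)
    (actN : V -> int -> N -> N) (i : N -> M) :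
  linear i -> injective i ->
  (forall u n x, i (actN u n x) = actM u n (i x)) ->
  is_representation (@va_par K V) (va_vac V) (va_mode V) parM actM ->
  is_representation (@va_par K V) (va_vac V) (va_mode V)
    (fun s x => parM s (i x)) actN.
Proof.
move=> lini inji iact [ll lr par trunc avac borch]; split.
- by move=> n x c u v; apply: inji; rewrite lini !iact ll.
- by move=> u n c x y; apply: inji; rewrite lini !iact lini lr.
- by move=> s t u n x us xt; rewrite iact; apply: par.
- move=> u x; have [N0 tN] := trunc u (i x).
  by exists N0 => n /tN iN; apply: inji; rewrite iact iN lin0.
- move=> n x; apply: inji; rewrite iact avac.
  by case: ifP => // _; rewrite lin0.
move=> s t u v x l m n us vt.
have [N0 bN] := borch s t u v (i x) l m n us vt.
exists N0 => k /bN bk; apply: inji; rewrite !(lin_sum lini).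
under eq_bigr do rewrite (linMz lini) iact.
under [RHS]eq_bigr do rewrite (linMz lini) (linB lini) (linZ lini) !iact.
exact: bk.
Qed.

Lemma parity_subspace (V : vertexAlg K) (M : vmodule V) s :
  subspace (vm_par M s).
Proof. by case: (vm_par_grading M) => sp _ _. Qed.

Lemma vm_act_linear (V : vertexAlg K) (M : vmodule V) u n :
  linear (vm_act M u n).
Proof. by case: (vm_representation M). Qed.

Lemma vm_act_linear_l (V : vertexAlg K) (M : vmodule V) n x :
  linear (fun u => vm_act M u n x).
Proof. by case: (vm_representation M). Qed.

(** The submodule generated by w is graded by parity because the vectors of it
whose even and odd parts both lie in it form a subspace that contains w and is
stable under all modes. *)
Lemma submodule_generated (V : vertexAlg K) (M : vmodule V) s (w : M) :
  vm_par M s w ->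
  exists (N : vmodule V) (i : N -> M) (w' : N),
    [/\ linear i /\ injective i,
        forall u n x, i (vm_act N u n x) = vm_act M u n (i x),
        forall t x, vm_par N t x <-> vm_par M t (i x),
        i w' = w & vm_generated w'].
Proof.
move=> ws; have [_ _ Vpar _ _ _] := vm_representation M.
(* The submodule is the intersection of all closed predicates. *)
pose closed P := [/\ subspace P, P w & forall u n x, P x -> P (vm_act M u n x)].
pose Q x := forall P, closed P -> P x.
have sQ : subspace Q.
  apply: subspace_forall => P; split=> [[]|c x y Px Py clP]; first by case.
  by case: (clP) => -[_ sP] _ _; apply: sP; [apply: Px | apply: Py].
have Qw : Q w by move=> P [].
have Qact u n x : Q x -> Q (vm_act M u n x).
  by move=> Qx P clP; case: (clP) => _ _; apply; apply: Qx.
pose i (x : subspace_sort sQ) : M := \val x.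
pose actN u n (x : subspace_sort sQ) : subspace_sort sQ :=
  subspace_in sQ (Qact u n _ (subspace_valP x)).
have lini : linear i by exact: subspace_val_linear.
have inji : injective i by exact: val_inj.
have repN := representation_restrict lini inji
  (fun u n x => erefl : i (actN u n x) = _) (vm_representation M).
have grN : is_grading (fun t (x : subspace_sort sQ) => vm_par M t (i x)).
  apply: is_grading_bool => [t|x|x x0 x1].
  - by apply: (subspace_preim lini); apply: parity_subspace.
  - pose P x := exists x0 x1, [/\ Q x0 /\ vm_par M false x0,
       Q x1 /\ vm_par M true x1 & x = x0 + x1].
    have sQpar t : subspace (fun x => Q x /\ vm_par M t x).
      by apply: subspace_and => //; apply: parity_subspace.
    have P_par t y : Q y -> vm_par M t y -> P y.
      case: t => Qy yt; [exists 0, y | exists y, 0]; split=> //;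
        rewrite ?addr0 ?add0r //.
        by case: (sQpar false).
      by case: (sQpar true).
    have sP : subspace P.
      split=> [|c y z]; first by exists 0, 0; split; rewrite ?addr0 //;
        [case: (sQpar false) | case: (sQpar true)].
      move=> [y0 [y1 [y0P y1P ->]]] [z0 [z1 [z0P z1P ->]]].
      exists (c *: y0 + z0), (c *: y1 + z1); split.
      - by case: (sQpar false) => _; apply.
      - by case: (sQpar true) => _; apply.
      - by rewrite scalerDr addrACA.
    have [] : P (i x).
      apply: (subspace_valP x); split=> // [|u n y [y0 [y1 [[Q0 p0] [Q1 p1] ->]]]].
        exact: P_par ws.
      have [u0 [u1 [pu0 pu1 ->]]] := grading_bool_decomp u (va_par_grading V).
      rewrite (linD (vm_act_linear _ _)) !(linD (vm_act_linear_l _ _)).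
      have Pact t t' u' y' : va_par V t u' -> Q y' -> vm_par M t' y' ->
        P (vm_act M u' n y').
        by move=> pu Qy py; apply: (P_par _ _ (Qact _ _ _ Qy)); apply: Vpar pu py.
      by apply: (subspaceD sP); apply: (subspaceD sP); eauto.
    move=> x0 [x1 [[Q0 p0] [Q1 p1] xE]].
    exists (subspace_in sQ Q0), (subspace_in sQ Q1); split=> //.
    by apply: inji; rewrite (linD lini).
  - apply: inji; rewrite lin0 //.
    exact: grading_bool_disjoint (vm_par_grading M) x0 x1.
exists (VModule grN repN), i, (subspace_in sQ Qw); split=> //.
move=> P sP Pw Pact x.
suff : exists Qx : Q (i x), P (subspace_in sQ Qx).
  by case=> Qx; rewrite (_ : subspace_in sQ Qx = x) //; apply: inji.
apply: (subspace_valP x (fun y => exists Qy : Q y, P (subspace_in sQ Qy))).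
split.
- split=> [|c y z [Qy Py] [Qz Pz]].
    have Q0 : Q 0 := proj1 sQ.
    exists Q0; rewrite (_ : subspace_in sQ Q0 = 0); first by case: sP.
    by apply: inji.
  have Qyz : Q (c *: y + z) := proj2 sQ c y z Qy Qz.
  exists Qyz; rewrite (_ : subspace_in _ _ = c *: subspace_in sQ Qy + subspace_in sQ Qz).
    by case: sP => _; apply.
  by apply: inji; rewrite lini.
- by exists Qw.
move=> u n y [Qy Py]; exists (Qact u n y Qy).
rewrite (_ : subspace_in _ _ = actN u n (subspace_in sQ Qy)); first exact: Pact.
exact: inji.
Qed.

End Transport.

(** * Products and divided derivatives of operator series *)
Section TriangularSums.
Variable V : zmodType.

Lemma sum_ord_widen (F : nat -> V) a b : (a <= b)%N ->
  \sum_(j < a) F j = \sum_(j < b) if (j < a)%N then F j else 0.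
Proof.
move=> ab; rewrite (@sum_ord_eventually0 _ (fun j => if (j < a)%N then F j else 0) a) //.
  by apply: eq_bigr => j _; rewrite ltn_ord.
by move=> j /andP[aj _]; rewrite ltnNge aj.
Qed.

Lemma triangular_exchange (F : nat -> nat -> V) n :
  \sum_(i < n.+1) \sum_(j < (n - i).+1) F i j =
  \sum_(j < n.+1) \sum_(i < (n - j).+1) F i j.
Proof.
transitivity (\sum_(i < n.+1) \sum_(j < n.+1) if (i + j <= n)%N then F i j else 0).
  apply: eq_bigr => i _; rewrite (@sum_ord_widen (F i) _ n.+1); last by lia.
  by apply: eq_bigr => j _; have := ltn_ord i => ?; congr (if _ then _ else _); lia.
rewrite exchange_big; apply: eq_bigr => j _.
rewrite (@sum_ord_widen (F^~ j) (n - j).+1 n.+1); last by lia.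
by apply: eq_bigr => i _; have := ltn_ord j => ?; congr (if _ then _ else _); lia.
Qed.

Lemma triangular_assoc (F : nat -> nat -> nat -> V) n :
  \sum_(i < n.+1) \sum_(j < i.+1) F j (i - j)%N (n - i)%N =
  \sum_(j < n.+1) \sum_(l < (n - j).+1) F j l (n - j - l)%N.
Proof.
transitivity (\sum_(i < n.+1) \sum_(j < n.+1)
    if (j <= i)%N then F j (i - j)%N (n - i)%N else 0).
  apply: eq_bigr => i _.
  by rewrite (@sum_ord_widen (fun j => F j (i - j) (n - i))%N i.+1 n.+1).
rewrite exchange_big; apply: eq_bigr => j _ /=.
rewrite -(big_mkord xpredT (fun i => if (j <= i)%N then F j (i - j)%N (n - i)%N else 0)).
rewrite (big_cat_nat (n := j)) //=; last by have := ltn_ord j; lia.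
rewrite big_nat_cond big1 ?add0r => [|i /andP[/andP[_ ij] _]]; last by rewrite leqNgt ij.
rewrite -{1}[nat_of_ord j]add0n big_addn (subSn (leq_ord j)) big_mkord.
by apply: eq_bigr => l _; rewrite leq_addl addnK addnC subnDA.
Qed.

End TriangularSums.

Lemma sum_nat_shift (V : nmodType) (F : nat -> V) i n :
  \sum_(i <= j < n) F j = \sum_(j < n - i) F (j + i)%N.
Proof. by rewrite -{1}(add0n i) big_addn big_mkord. Qed.

Lemma bin_trinomial_revision (a j i : nat) : (i <= j)%N ->
  ('C(a, j) * 'C(j, i) = 'C(a, i) * 'C(a - i, j - i))%N.
Proof.
move=> ij; have [ja|aj] := leqP j a; last first.
  rewrite bin_small // mul0n; have [ia|ai] := leqP i a.
    by rewrite [X in (_ * X)%N]bin_small ?muln0 //; lia.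
  by rewrite bin_small.
have ia := leq_trans ij ja.
apply/eqP; rewrite -(eqn_pmul2r (fact_gt0 i)) -(eqn_pmul2r (fact_gt0 (j - i))).
rewrite -(eqn_pmul2r (fact_gt0 (a - j))); apply/eqP.
transitivity ('C(a, j) * ('C(j, i) * (i`! * (j - i)`!)) * (a - j)`!)%N; first by ring.
rewrite bin_fact // -mulnA bin_fact //.
transitivity
  ('C(a, i) * (i`! * ('C(a - i, j - i) * ((j - i)`! * (a - i - (j - i))`!))))%N.
  by rewrite bin_fact ?bin_fact //; lia.
by rewrite (_ : a - i - (j - i) = a - j)%N; [ring | lia].
Qed.

(** Compares the coefficients of u_a v_b w_c in the two sides of the
associativity of series composition. *)
Lemma bin_product_sum (a b n i : nat) :
  (\sum_(j < (n + i).+1) 'C(b, n + i - j) * 'C(a, j) * 'C(j, i) =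
   'C(a, i) * 'C(a + b - i, n))%N.
Proof.
rewrite -(big_mkord xpredT (fun j => 'C(b, n + i - j) * 'C(a, j) * 'C(j, i))%N).
rewrite (big_cat_nat (n := i)) //=; last by lia.
rewrite big_nat_cond big1 ?add0n => [|j /andP[/andP[_ ji] _]]; last first.
  by rewrite [X in (_ * X)%N]bin_small // muln0.
rewrite -{1}(add0n i) big_addn -addSn addnK big_mkord.
under eq_bigr => l _.
  rewrite -mulnA bin_trinomial_revision ?leq_addl // addnK subnDr mulnCA.
  over.
rewrite -big_distrr /=; have [ia|ai] := leqP i a; last by rewrite bin_small.
congr (_ * _)%N; rewrite addnC -addnBA // addnC -binomial.Vandermonde.
by apply: eq_bigr => l _; rewrite mulnC.
Qed.

Section Composition.
Variables (K : fieldType) (W : lmodType K).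
Notation series := (nat -> W -> W).
Implicit Types u v w : series.

(** The coefficients of (1/i!) u^(i)(z) v(z), where u(z) = sum_n u_n z^n and the
product is composition of operators. *)
Definition series_comp u i v : series := fun n x =>
  \sum_(j < (n + i).+1) u j (v (n + i - j)%N x) *+ 'C(j, i).

Definition series_one : series := fun n x => if n == 0%N then x else 0.

Definition series_linear u := forall n, linear (u n).

(** The i-th and n-th divided derivatives of a product are expanded by the
Leibniz rule on the left, and collected by it on the right. *)
Lemma series_compA u v w i n N x : series_linear u ->
  series_comp (series_comp u i v) n w N x =
  \sum_(j < (n + i).+1) series_comp u j (series_comp v (n + i - j) w) N x *+ 'C(j, i).
Proof.
move=> lu; pose M := (N + n + i)%N.
pose X a b c := u a (v b (w c x)).
transitivity (\sum_(a < M.+1) \sum_(b < (M - a).+1)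
    X a b (M - a - b)%N *+ ('C(a, i) * 'C(a + b - i, n))).
  rewrite -(triangular_assoc (fun a b c => X a b c *+ ('C(a, i) * 'C(a + b - i, n)))).
  rewrite -(big_mkord xpredT (fun g => \sum_(a < g.+1)
    X a (g - a)%N (M - g)%N *+ ('C(a, i) * 'C(a + (g - a) - i, n)))).
  rewrite (big_cat_nat (n := i)) //=; last by rewrite /M; lia.
  rewrite big_nat_cond big1 ?add0r => [|g /andP[/andP[_ gi] _]]; last first.
    by rewrite big1 // => a _; rewrite bin_small //; have := ltn_ord a; lia.
  rewrite sum_nat_shift -addSn addnK.
  apply: eq_bigr => g _; rewrite /series_comp -sumrMnl; apply: eq_bigr => a _.
  rewrite -mulrnA /X (_ : M - (g + i) = N + n - g)%N; last by rewrite /M; lia.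
  by rewrite (_ : a + (g + i - a) - i = g)%N //; have := ltn_ord a; lia.
transitivity (\sum_(a < M.+1) \sum_(j < (n + i).+1) \sum_(b < (M - a).+1)
    X a b (M - a - b)%N *+ ('C(b, n + i - j) * 'C(a, j) * 'C(j, i))).
  apply: eq_bigr => a _; rewrite exchange_big; apply: eq_bigr => b _ /=.
  by rewrite -bin_product_sum -sumrMnr.
rewrite exchange_big /=; apply: eq_bigr => j _.
have jn := ltn_ord j.
rewrite /(series_comp u j) -sumrMnl.
rewrite (@sum_ord_eventually0 _ (fun a => \sum_(b < (M - a).+1) X a b (M - a - b)%N *+
   ('C(b, n + i - j) * 'C(a, j) * 'C(j, i))) (N + j).+1); last 2 first.
- by rewrite /M; lia.
- move=> a /andP[aN aM]; rewrite big1 // => b _; have := ltn_ord b => bM.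
  by rewrite bin_small ?mulr0n //; move: aM bM; rewrite /M; lia.
apply: eq_bigr => a _; have aN := ltn_ord a.
rewrite (lin_sum (lu a)) /series_comp.
rewrite (_ : N + j - a + (n + i - j) = M - a)%N; last by rewrite /M; lia.
rewrite -sumrMnl -sumrMnl; apply: eq_bigr => b _.
by rewrite (linMn (lu a)) !mulrnA.
Qed.

End Composition.

Section CompositionLinear.
Variables (K : fieldType) (W : lmodType K).
Notation series := (nat -> W -> W).
Implicit Types u v w : series.

Lemma series_comp_linear_l i v : linear (fun u : series => series_comp u i v).
Proof.
move=> c u u'; apply/funext => n; apply/funext => x.
rewrite -[RHS]/(c *: series_comp u i v n x + series_comp u' i v n x).
rewrite /series_comp scaler_sumr -big_split; apply: eq_bigr => j _ /=.
by rewrite mulrnDl scalerMnr.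
Qed.

Lemma series_comp_linear_r u i : series_linear u -> linear (series_comp u i).
Proof.
move=> lu c v v'; apply/funext => n; apply/funext => x.
rewrite -[RHS]/(c *: series_comp u i v n x + series_comp u i v' n x).
rewrite /series_comp scaler_sumr -big_split; apply: eq_bigr => j _ /=.
by rewrite lu mulrnDl scalerMnr.
Qed.

Lemma series_one_comp i v :
  series_comp (@series_one K W) i v = if i == 0%N then v else 0.
Proof.
apply/funext => n; apply/funext => x; rewrite /series_comp big_ord_recl /=.
rewrite big1 ?addr0 => [|j _]; last by rewrite mul0rn.
by case: i => [|i]; rewrite ?bin0 ?mulr1n ?addn0 ?subn0 ?bin0n ?mulr0n.
Qed.

Lemma series_comp_one u : series_linear u -> series_comp u 0 (@series_one K W) = u.
Proof.
move=> lu; apply/funext => n; apply/funext => x.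
rewrite /series_comp addn0 big_ord_recr /= subnn /series_one eqxx bin0.
rewrite big1 ?add0r // => j _.
by rewrite ifN ?(lin0 (lu _)) ?mul0rn //; have := ltn_ord j; lia.
Qed.

Lemma series_compA_fun u v w i n : series_linear u ->
  series_comp (series_comp u i v) n w =
  \sum_(j < (n + i).+1) series_comp u j (series_comp v (n + i - j) w) *+ 'C(j, i).
Proof.
move=> lu; apply/funext => N; apply/funext => x.
rewrite series_compA //.
rewrite !fct_sumE; apply: eq_bigr => j _.
by elim: 'C(j, i) => [|c IHc] //; rewrite !mulrSr IHc.
Qed.

Lemma series_comp_comm u v w (c : K) i j N x :
  series_linear u -> series_linear v ->
  (forall k l y, u k (v l y) = c *: v l (u k y)) ->
  series_comp u i (series_comp v j w) N x =
  c *: series_comp v j (series_comp u i w) N x.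
Proof.
move=> lu lv uv; pose M := (N + i + j)%N.
have expand u' v' i' j' : series_linear u' -> M = (N + i' + j')%N ->
    series_comp u' i' (series_comp v' j' w) N x =
    \sum_(a < M.+1) \sum_(b < (M - a).+1)
      u' a (v' b (w (M - a - b)%N x)) *+ 'C(b, j') *+ 'C(a, i').
  move=> lu' ME; rewrite (@sum_ord_eventually0 _ (fun a => \sum_(b < (M - a).+1)
      u' a (v' b (w (M - a - b)%N x)) *+ 'C(b, j') *+ 'C(a, i')) (N + i').+1).
  - apply: eq_bigr => a _; have aN := ltn_ord a.
    rewrite /series_comp (lin_sum (lu' a)) (_ : N + i' - a + j' = M - a)%N; last by lia.
    by rewrite -sumrMnl; apply: eq_bigr => b _; rewrite (linMn (lu' a)).
  - by lia.
  move=> a /andP[aN aM]; rewrite big1 // => b _; have := ltn_ord b => bM.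
  by rewrite [X in _ *+ X *+ _]bin_small ?mulr0n ?mul0rn //; lia.
rewrite (expand u v) // (expand v u) //; last by rewrite /M addnAC.
rewrite (triangular_exchange
  (fun a b => u a (v b (w (M - a - b)%N x)) *+ 'C(b, j) *+ 'C(a, i))).
rewrite scaler_sumr; apply: eq_bigr => b _; rewrite scaler_sumr; apply: eq_bigr => a _.
by rewrite uv -!scalerMnr -!mulrnA mulnC (_ : M - a - b = M - b - a)%N //; lia.
Qed.

End CompositionLinear.

(** Locality of order - p is the Borcherds identity at n = - p, whose left side
involves only the products a_(n) a with n >= - p. *)
Lemma locality_of_products (K : fieldType) (V : vertexAlg K) (p : nat) (a : V) :
  va_par V (odd p) a -> (forall n : int, - p%:Z <= n -> va_mode V a n a = 0) ->
  va_locality p a.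
Proof.
move=> pa a0 i j x; case: (va_adjoint V) => ll lr _ _ _ borch.
have [N0 bN] := borch _ _ _ _ x j i (- p%:Z) pa pa.
exists N0 => N /bN; rewrite big1 => [|k _]; last first.
  by rewrite a0; [rewrite (lin0 (ll _ _)) mul0rz | lia].
move/esym => sum0; apply/eqP; rewrite -subr_eq0 -sumrB; apply/eqP.
rewrite -[RHS]sum0; apply: eq_bigr => k _.
have sgn : (-1) ^+ (p + odd p) = 1 :> K.
  by rewrite -signr_odd oddD; case: (odd p).
by rewrite andbb abszN absz_nat sgn scale1r mulrzBl (addrC (- p%:Z) j).
Qed.

(** * The vertex algebra generated by a series of supercommuting operators *)
Section OperatorAlgebra.
Variables (K : fieldType) (W : lmodType K) (parW : bool -> W -> Prop).
Hypothesis grW : is_grading parW.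
Notation series := (nat -> W -> W).
Variables (p : nat) (a : series).
Hypothesis a_linear : series_linear a.
Hypothesis a_par : forall s i x, parW s x -> parW (odd p (+) s) (a i x).
Hypothesis a_comm : forall i j x, a i (a j x) = (-1) ^+ p *: a j (a i x).
Hypothesis a_rel : forall j s x, (j < p)%N ->
  \sum_(i < s.+1) a i (a (s - i)%N x) *+ 'C(i, j) = 0.
Implicit Types u v w : series.

(** The product of the divided derivatives of a of orders js. *)
Definition op_mono (js : seq nat) : series :=
  foldr (fun j u => series_comp a j u) (@series_one K W) js.

Definition op_par (s : bool) : series -> Prop :=
  spanned (fun u => exists js, u = op_mono js /\ s = odd (p * size js)).

Definition op_space : series -> Prop :=
  spanned (fun u => exists js, u = op_mono js).

Lemma op_par_space s u : op_par s u -> op_space u.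
Proof.
move=> us; apply: us => [|_ [js [-> _]]]; first exact: spanned_subspace.
by apply: spanned_gen; exists js.
Qed.

Lemma series_linear_subspace : subspace (@series_linear K W).
Proof.
split=> [n|c u v lu lv n] b x y.
  by rewrite -[LHS]/(0 : W) -[RHS]/(b *: (0 : W) + 0) scaler0 addr0.
rewrite -[LHS]/(c *: u n (b *: x + y) + v n (b *: x + y)) lu lv.
rewrite -[RHS]/(b *: (c *: u n x + v n x) + (c *: u n y + v n y)).
by rewrite !scalerDr !scalerA [b * c]mulrC addrACA.
Qed.

Lemma op_mono_linear js : series_linear (op_mono js).
Proof.
elim: js => [|j js IHjs] n c x y /=.
  by rewrite /series_one; case: ifP => // _; rewrite scaler0 addr0.
rewrite /series_comp scaler_sumr -big_split; apply: eq_bigr => i _ /=.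
by rewrite IHjs a_linear mulrnDl scalerMnr.
Qed.

Lemma op_linear u : op_space u -> series_linear u.
Proof.
apply; first exact: series_linear_subspace.
by move=> _ [js ->]; apply: op_mono_linear.
Qed.

Lemma op_eval_linear n (x : W) : linear (fun u : series => u n x).
Proof. by []. Qed.

Lemma op_act_par s t u n x : op_par s u -> parW t x -> parW (s (+) t) (u n x).
Proof.
move=> us xt; have [sP _ _] := grW.
apply: (us (fun u => parW (s (+) t) (u n x))).
  exact: (subspace_preim (op_eval_linear n x)).
move=> _ [js [-> ->]] {s u us}; elim: js n => [|j js IHjs] n.
  by rewrite muln0 /= /series_one; case: ifP => // _; exact: (proj1 (sP t)).
apply: (subspace_sum _ (sP _)) => i _; apply: (subspaceMn _ (sP _)).
by rewrite /= mulnS oddD -addbA; apply: a_par.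
Qed.

Lemma a_op_mono_comm i js j x :
  a i (op_mono js j x) = (-1) ^+ (p * size js) *: op_mono js j (a i x).
Proof.
elim: js j => [|k js IHjs] j /=.
  rewrite muln0 scale1r /series_one; case: ifP => // _; exact: lin0.
rewrite /series_comp (lin_sum (a_linear i)) scaler_sumr; apply: eq_bigr => l _.
rewrite (linMn (a_linear i)) a_comm IHjs (linZ (a_linear l)) scalerA.
by rewrite scalerMnr mulnS exprD.
Qed.

Lemma op_mono_comm i j js ks x :
  op_mono js i (op_mono ks j x) =
  (-1) ^+ (odd (p * size js) && odd (p * size ks)) *: op_mono ks j (op_mono js i x).
Proof.
rewrite -oddM signr_odd; elim: js i => [|k js IHjs] i /=.
  rewrite muln0 mul0n scale1r /series_one; case: ifP => // _.
  by rewrite (lin0 (op_mono_linear ks j)).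
rewrite /series_comp (lin_sum (op_mono_linear ks j)) scaler_sumr.
apply: eq_bigr => l _; rewrite IHjs (linZ (a_linear l)) a_op_mono_comm scalerA.
rewrite (linMn (op_mono_linear ks j)) scalerMnr -exprD mulnS mulnDl.
congr (_ *: _); rewrite addnC -[LHS]signr_odd -[RHS]signr_odd !oddD.
congr (_ ^+ (nat_of_bool (_ (+) _))).
by rewrite mulnA !oddM; case: (odd p).
Qed.

Lemma op_comm s t u v i j x : op_par s u -> op_par t v ->
  u i (v j x) = (-1) ^+ (s && t) *: v j (u i x).
Proof.
move=> us vt; have lv := op_linear (op_par_space vt).
apply: (us (fun u => u i (v j x) = (-1) ^+ (s && t) *: v j (u i x))).
  apply: subspace_eq => [//|c w w' /=].
  rewrite -[(c *: w + w') i x]/(c *: w i x + w' i x).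
  by rewrite lv scalerDr !scalerA [_ * c]mulrC.
move=> _ [js [-> ->]] {us u}; have lm := op_mono_linear js i.
apply: (vt (fun v => op_mono js i (v j x) =
   (-1) ^+ (odd (p * size js) && t) *: v j (op_mono js i x))).
  apply: subspace_eq => [c w w' |c w w'].
    by rewrite -[(c *: w + w') j x]/(c *: w j x + w' j x) lm.
  by rewrite -[(c *: w + w') j _]/(c *: w j _ + w' j _) scalerDr !scalerA [_ * c]mulrC.
by move=> _ [ks [-> ->]]; apply: op_mono_comm.
Qed.

Lemma op_a_comp t v j : op_par t v -> op_par (odd p (+) t) (series_comp a j v).
Proof.
move=> vt; apply: (vt (fun v => op_par (odd p (+) t) (series_comp a j v))).
  exact: (subspace_preim (series_comp_linear_r j a_linear) (spanned_subspace _)).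
move=> _ [ks [-> ->]]; apply: spanned_gen.
by exists (j :: ks); rewrite /= mulnS oddD.
Qed.

Lemma op_comp_par s t u v i :
  op_par s u -> op_par t v -> op_par (s (+) t) (series_comp u i v).
Proof.
move=> us vt; apply: (us (fun u => op_par (s (+) t) (series_comp u i v))).
  exact: (subspace_preim (series_comp_linear_l i v) (spanned_subspace _)).
move=> _ [js [-> ->]] {s u us}; elim: js i => [|j js IHjs] i /=.
  rewrite muln0 series_one_comp; case: ifP => // _.
  exact: (proj1 (spanned_subspace _)).
rewrite (series_compA_fun _ _ _ _ a_linear).
apply: (subspace_sum _ (spanned_subspace _)) => k _.
apply: (subspaceMn _ (spanned_subspace _)); rewrite mulnS oddD -addbA.
by apply: op_a_comp; apply: IHjs.
Qed.

Lemma op_decomp u : op_space u ->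
  exists u0 u1, [/\ op_par false u0, op_par true u1 & u = u0 + u1].
Proof.
have s0 s : subspace (op_par s) by apply: spanned_subspace.
move=> uS; apply: (uS (fun u => exists u0 u1,
  [/\ op_par false u0, op_par true u1 & u = u0 + u1])) => [|{u uS} _ [js ->]].
  split=> [|c v w [v0 [v1 [pv0 pv1 ->]]] [w0 [w1 [pw0 pw1 ->]]]].
    by exists 0, 0; rewrite addr0; split=> //; apply: (proj1 (s0 _)).
  exists (c *: v0 + w0), (c *: v1 + w1); split; last by rewrite scalerDr addrACA.
    exact: (proj2 (s0 _)).
  exact: (proj2 (s0 _)).
have mjs : op_par (odd (p * size js)) (op_mono js) by apply: spanned_gen; exists js.
case: (odd _) mjs => mjs; [exists 0, (op_mono js) | exists (op_mono js), 0];
  by rewrite ?addr0 ?add0r; split=> //; apply: (proj1 (s0 _)).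
Qed.

Lemma op_space_comp u v i : op_space u -> op_space v -> op_space (series_comp u i v).
Proof.
move=> /op_decomp[u0 [u1 [pu0 pu1 ->]]] /op_decomp[v0 [v1 [pv0 pv1 ->]]].
have sV : subspace op_space by apply: spanned_subspace.
have lu t w : op_par t w -> series_linear w by move/op_par_space/op_linear.
rewrite (linD (series_comp_linear_l _ _)) !(linD (series_comp_linear_r _ _)); eauto.
have comp_in s t w w' : op_par s w -> op_par t w' -> op_space (series_comp w i w').
  by move=> ws wt; apply: op_par_space (op_comp_par i ws wt).
by apply: (subspaceD sV); apply: (subspaceD sV); eauto.
Qed.

(** The parity of a series is determined by how it moves the parity of W,
unless the series is zero. *)
Lemma op_par_disjoint u : op_par false u -> op_par true u -> u = 0.
Proof.
move=> u0 u1; apply/funext => n; apply/funext => x.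
have lu := op_linear (op_par_space u0) n.
have [x0 [x1 [px0 px1 ->]]] := grading_bool_decomp x grW.
rewrite (linD lu) (grading_bool_disjoint (v := u n x0) grW); last 2 first.
- exact: op_act_par u0 px0.
- exact: op_act_par u1 px0.
rewrite add0r (grading_bool_disjoint (v := u n x1) grW) //.
- exact: op_act_par u1 px1.
- exact: op_act_par u0 px1.
Qed.

Let op_space_subspace : subspace op_space. Proof. exact: spanned_subspace. Qed.

Let alg := subspace_sort op_space_subspace.
Let alg_par s (u : alg) := op_par s (\val u).
Let alg_comp (u : alg) i (v : alg) : alg :=
  subspace_in op_space_subspace (op_space_comp i (subspace_valP u) (subspace_valP v)).
Let alg_one : alg := subspace_in op_space_subspace
  (spanned_gen (ex_intro (fun js => @series_one K W = op_mono js) [::] erefl)).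

Let val_lin : linear (\val : alg -> series). Proof. exact: subspace_val_linear. Qed.

Let alg_linear (u : alg) : series_linear (\val u).
Proof. exact: op_linear (subspace_valP u). Qed.

Let parW_subspace s : subspace (parW s). Proof. by case: grW. Qed.

Let alg_par_grading : is_grading alg_par.
Proof.
apply: is_grading_bool => [s|u|u u0 u1].
- exact: (subspace_preim val_lin (spanned_subspace _)).
- have [u0 [u1 [pu0 pu1 uE]]] := op_decomp (subspace_valP u).
  exists (subspace_in op_space_subspace (op_par_space pu0)).
  exists (subspace_in op_space_subspace (op_par_space pu1)).
  by split=> //; apply: val_inj; rewrite (linD val_lin).
- by apply: val_inj; rewrite (lin0 val_lin); apply: op_par_disjoint.
Qed.

Let alg_adjoint :
  is_representation alg_par alg_one (modes 0 alg_comp) alg_par (modes 0 alg_comp).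
Proof.
apply: comm_representation
  => [s|i v c u u'|u i c v v'|s t u i v|i v|u i v n w|s t u v i j w us vt].
- exact: (subspace_preim val_lin (spanned_subspace _)).
- by apply: val_inj; rewrite val_lin /= -series_comp_linear_l -val_lin.
- apply: val_inj; rewrite val_lin /=.
  by rewrite -(series_comp_linear_r i (alg_linear u)) -val_lin.
- exact: op_comp_par.
- apply: val_inj; rewrite /= series_one_comp.
  by case: ifP => // _; rewrite (lin0 val_lin).
- apply: val_inj; rewrite (lin_sum val_lin) /= (series_compA_fun _ _ _ _ (alg_linear u)).
  by apply: eq_bigr => j _; rewrite (linMn val_lin).
apply: val_inj; rewrite (linZ val_lin) /=; apply/funext => n; apply/funext => x.
apply: (series_comp_comm _ _ _ _ _ (alg_linear u) (alg_linear v)) => k l y.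
exact: op_comm us vt.
Qed.

Let minus1 : -1 = Negz 0. Proof. by []. Qed.

Let alg_creation (u : alg) : modes 0 alg_comp u (-1) alg_one = u.
Proof. by rewrite minus1; apply: val_inj; apply: series_comp_one. Qed.

Let alg_creation0 (u : alg) (n : int) : 0 <= n -> modes 0 alg_comp u n alg_one = 0.
Proof. by case: n. Qed.

Let alg_one_even : alg_par false alg_one.
Proof. by apply: spanned_gen; exists [::]; rewrite muln0. Qed.

Let opVA : vertexAlg K :=
  VertexAlg alg_par_grading alg_one_even alg_adjoint alg_creation alg_creation0.

Let a_mono : op_mono [:: 0%N] = a. Proof. exact: series_comp_one. Qed.

Let a_in_par : op_par (odd p) a.
Proof. by apply: spanned_gen; exists [:: 0%N]; rewrite a_mono muln1. Qed.

Let opa : opVA := subspace_in op_space_subspace (op_par_space a_in_par).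

Let opa_act (u : opVA) n x := modes 0 (fun (u : opVA) i x => (\val u : series) i x) u n x.

Let opa_representation :
  is_representation (va_par opVA) (va_vac opVA) (va_mode opVA) parW opa_act.
Proof.
pose act (u : opVA) i x := (\val u : series) i x.
apply: (@comm_representation _ _ _ alg_par alg_one alg_comp parW act).
- exact: parW_subspace.
- by [].
- exact: alg_linear.
- by move=> s t u i x; apply: op_act_par.
- by [].
- by [].
- by move=> s t u v i j x; apply: op_comm.
Qed.

Let opa_comp0 (n : int) : - p%:Z <= n -> va_mode opVA opa n opa = 0.
Proof.
case: n => // j pj; apply: val_inj; rewrite (lin0 val_lin).
apply/funext => n; apply/funext => x.
rewrite -[RHS]/(0 : W) -(a_rel (n + j) x (_ : (j < p)%N)) //.
by lia.
Qed.

(** The monomials in the divided derivatives of a span an algebra of series that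
is closed under products, by associativity, and under divided derivatives, by
the Leibniz rule. [comm_representation] applies to its action on itself, which
makes it a vertex algebra, and to its action on W. The relations [a_rel] say
that a times its j-th derivative vanishes for j < p, which gives locality. *)
Lemma operator_vertex_algebra (k : nat) : (forall i x, (k <= i)%N -> a i x = 0) ->
  exists (V : vertexAlg K) (b : V) (act : V -> int -> W -> W),
  [/\ locally_generated p b,
      is_representation (va_par V) (va_vac V) (va_mode V) parW act,
      forall n x, act b n x = if n is Negz i then a i x else 0
    & forall i (u : V), (k <= i)%N -> va_mode V b (Negz i) u = 0].
Proof.
move=> a_bound; exists opVA, opa, opa_act; split=> //.
- split=> //; first exact: (@locality_of_products K opVA p opa a_in_par opa_comp0).
  move=> P sP P1 Pa Pmul u.
  suff Pin v : op_space v -> exists Pv : op_space v, P (subspace_in op_space_subspace Pv).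
    have [Pv] := Pin _ (subspace_valP u).
    by rewrite (_ : subspace_in op_space_subspace Pv = u) //; apply: val_inj.
  move=> Sv; apply: (Sv (fun v => exists Pv : op_space v,
    P (subspace_in op_space_subspace Pv))) => [|{v Sv} _ [js ->]].
    have [P0 P2] := sP; split=> [|c w w' [Qw Pw] [Qw' Pw']].
      exists (proj1 op_space_subspace); rewrite (_ : subspace_in _ _ = 0) //.
      exact: val_inj.
    exists (proj2 op_space_subspace c w w' Qw Qw').
    rewrite (_ : subspace_in _ _ = c *: subspace_in op_space_subspace Qw
       + subspace_in op_space_subspace Qw'); first exact: P2.
    by apply: val_inj; rewrite val_lin.
  elim: js => [|j js [Qjs Pjs]].
    exists (subspace_valP alg_one); rewrite (_ : subspace_in _ _ = alg_one) //.
    exact: val_inj.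
  exists (op_space_comp j (subspace_valP opa) Qjs).
  by have := Pmul _ (Negz j) _ Pa Pjs; congr P; apply: val_inj.
move=> i u ki; apply: val_inj; rewrite (lin0 val_lin).
apply/funext => n; apply/funext => x.
rewrite /= /series_comp big1 // => j _.
have [ij|ji] := leqP i j; first by rewrite a_bound ?mul0rn //; lia.
by rewrite bin_small.
Qed.

End OperatorAlgebra.

(** * Arrays of polynomial coefficients *)
Section Arrays.
Variable K : fieldType.
Implicit Types (f g : seq nat -> K) (u v w : seq nat).

(** An array f is read as the family, over r, of the polynomials
sum_w f(w) z_1^(w_0) ... z_r^(w_(r-1)), w running over the words of length r. *)
Definition swap_symmetric (e : nat) f := forall w i j u,
  f (w ++ i :: j :: u) = (-1) ^+ e * f (w ++ j :: i :: u).

(** The polynomials are divisible by (z - z')^p for any two adjacent variables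
z, z': the sum is the coefficient of z^(s-j) in the restriction to z = z' of the
j-th divided derivative along z. *)
Definition diagonal_order (p : nat) f := forall w s j u, (j < p)%N ->
  \sum_(i < s.+1) f (w ++ (i : nat) :: (s - i)%N :: u) *+ 'C(i, j) = 0.

(** The product of polynomials in the same number of variables. *)
Fixpoint conv f g w : K :=
  if w is n :: w' then
    \sum_(i < n.+1) conv (fun u => f (nat_of_ord i :: u)) (fun u => g ((n - i)%N :: u)) w'
  else f [::] * g [::].

Lemma eq_conv f f' g g' w : f =1 f' -> g =1 g' -> conv f g w = conv f' g' w.
Proof. by move=> /funext -> /funext ->. Qed.

Lemma convZ c d f g w :
  conv (fun u => c * f u) (fun u => d * g u) w = c * d * conv f g w.
Proof.
elim: w f g => [|n w IHw] f g /=; first by rewrite mulrACA.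
by rewrite mulr_sumr; apply: eq_bigr => i _; apply: IHw.
Qed.

Lemma conv0l g w : conv (fun _ => 0) g w = 0.
Proof.
have E := convZ 0 1 (fun _ => 0) g w; rewrite ?(mulr0, mul0r) in E; rewrite -[RHS]E.
by apply: eq_conv => u; rewrite ?mulr0 ?mul1r.
Qed.

Lemma conv0r f w : conv f (fun _ => 0) w = 0.
Proof.
have E := convZ 1 0 f (fun _ => 0) w; rewrite ?(mulr0, mul0r) in E; rewrite -[RHS]E.
by apply: eq_conv => u; rewrite ?mulr0 ?mul1r.
Qed.

Lemma conv_suml n (F : nat -> seq nat -> K) (c : nat -> nat) g w :
  conv (fun u => \sum_(i < n) F i u *+ c i) g w = \sum_(i < n) conv (F i) g w *+ c i.
Proof.
elim: w F g => [|k w IHw] F g /=.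
  by rewrite mulr_suml; apply: eq_bigr => i _; rewrite mulrnAl.
under eq_bigr => j _ do rewrite (IHw (fun i u => F i (nat_of_ord j :: u))).
by rewrite exchange_big; apply: eq_bigr => i _; rewrite -sumrMnl.
Qed.

Lemma conv_sumr n (F : nat -> seq nat -> K) (c : nat -> nat) f w :
  conv f (fun u => \sum_(i < n) F i u *+ c i) w = \sum_(i < n) conv f (F i) w *+ c i.
Proof.
elim: w F f => [|k w IHw] F f /=.
  by rewrite mulr_sumr; apply: eq_bigr => i _; rewrite mulrnAr.
under eq_bigr => j _ do rewrite (IHw (fun i u => F i ((k - j)%N :: u))).
by rewrite exchange_big; apply: eq_bigr => i _; rewrite -sumrMnl.
Qed.

Lemma conv_swap_symmetric e e' f g :
  swap_symmetric e f -> swap_symmetric e' g -> swap_symmetric (e + e') (conv f g).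
Proof.
move=> sf sg w i j u; elim: w f g sf sg => [|n w IHw] f g sf sg /=; last first.
  rewrite mulr_sumr; apply: eq_bigr => k _; apply: IHw => w' i' j' u'.
    exact: (sf (nat_of_ord k :: w')).
  exact: (sg ((n - k)%N :: w')).
rewrite exchange_big mulr_sumr; apply: eq_bigr => b _.
rewrite mulr_sumr; apply: eq_bigr => c _ /=.
rewrite exprD -convZ; apply: eq_conv => v; first exact: (sf [::]).
exact: (sg [::]).
Qed.

(** By the Leibniz rule the j-th derivative of the product along z is a sum of
products of an e-th and a (j - e)-th derivative. If j < p + p', then e < p or
j - e < p', so one factor vanishes on the diagonal. *)
Lemma conv_diagonal_order p p' f g :
  diagonal_order p f -> diagonal_order p' g -> diagonal_order (p + p') (conv f g).
Proof.
move=> df dg w s j u jp; elim: w f g df dg => [|n w IHw] f g df dg /=; last first.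
  under eq_bigr do rewrite -sumrMnl.
  rewrite exchange_big big1 // => k _ /=; apply: IHw => w' s' j' u'.
    exact: (df (nat_of_ord k :: w')).
  exact: (dg ((n - k)%N :: w')).
pose H i l i' l' := conv (fun v => f (i :: l :: v)) (fun v => g (i' :: l' :: v)) u.
transitivity (\sum_(a < s.+1) \sum_(i < a.+1) \sum_(l < (s - a).+1)
    H i l (a - i)%N (s - a - l)%N *+ 'C(i + (a - i), j)).
  apply: eq_bigr => a _; rewrite -sumrMnl; apply: eq_bigr => i _.
  rewrite -sumrMnl; apply: eq_bigr => l _.
  by rewrite subnKC // -ltnS.
rewrite (triangular_assoc
  (fun i i' n => \sum_(l < n.+1) H i l i' (n - l)%N *+ 'C(i + i', j))).
transitivity (\sum_(i < s.+1) \sum_(l < (s - i).+1) \sum_(i' < (s - i - l).+1)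
    H i l i' (s - i - l - i')%N *+ 'C(i + i', j)).
  apply: eq_bigr => i _.
  rewrite (triangular_exchange
    (fun i' l => H i l i' (s - i - i' - l)%N *+ 'C(i + i', j))).
  by apply: eq_bigr => l _; apply: eq_bigr => i' _; rewrite (subnAC (s - i)%N i' l).
rewrite -(triangular_assoc
  (fun i l n => \sum_(i' < n.+1) H i l i' (n - i')%N *+ 'C(i + i', j))).
apply: big1 => s1 _.
transitivity (\sum_(e < j.+1) \sum_(i < s1.+1) (\sum_(i' < (s - s1).+1)
    H i (s1 - i)%N i' (s - s1 - i')%N *+ 'C(i', j - e)) *+ 'C(i, e)).
  rewrite [RHS]exchange_big; apply: eq_bigr => i _.
  under [RHS]eq_bigr do rewrite -sumrMnl.
  rewrite [RHS]exchange_big; apply: eq_bigr => i' _.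
  rewrite -binomial.Vandermonde -sumrMnr; apply: eq_bigr => e _.
  by rewrite -mulrnA mulnC.
apply: big1 => e _.
transitivity (\sum_(i < s1.+1) conv (fun v => f ((i : nat) :: (s1 - i)%N :: v))
   (fun v => \sum_(i' < (s - s1).+1) g ((i' : nat) :: (s - s1 - i')%N :: v)
      *+ 'C(i', j - e)) u *+ 'C(i, e)).
  apply: eq_bigr => i _; congr (_ *+ _); symmetry.
  exact: (conv_sumr _ (fun i' v => g (i' :: (s - s1 - i')%N :: v))
    (fun i' => 'C(i', j - e))).
rewrite -(conv_suml _ (fun i v => f (i :: (s1 - i)%N :: v)) (fun i => 'C(i, e))).
have [ep|pe] := ltnP e p.
  rewrite (@eq_conv _ (fun _ => 0) _ _ u (fun v => df [::] s1 e v ep) (frefl _)).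
  exact: conv0l.
have jep : (j - e < p')%N by have := ltn_ord e; lia.
rewrite (@eq_conv _ _ _ (fun _ => 0) u (frefl _) (fun v => dg [::] _ _ v jep)).
exact: conv0r.
Qed.

End Arrays.

(** * Leading monomials with respect to the weight *)
Section LeadingWords.

(** The sum of t w_t, the letters being numbered from t = 0. It is additive in
the exponents, and smallest on the decreasing rearrangement of a word. *)
Fixpoint weight (w : seq nat) : nat :=
  if w is _ :: w' then (sumn w' + weight w')%N else 0%N.

Definition word_add (u v : seq nat) : seq nat := [seq (x.1 + x.2)%N | x <- zip u v].

Lemma size_word_add u v : size u = size v -> size (word_add u v) = size u.
Proof. by move=> uv; rewrite size_map size1_zip // uv. Qed.

Lemma sumn_word_add u v : size u = size v -> sumn (word_add u v) = (sumn u + sumn v)%N.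
Proof.
by elim: u v => [|x u IHu] [|y v] //= [uv]; rewrite -/(word_add u v) IHu //; lia.
Qed.

Lemma weight_word_add u v : size u = size v ->
  weight (word_add u v) = (weight u + weight v)%N.
Proof.
elim: u v => [|x u IHu] [|y v] //= [uv].
by rewrite -/(word_add u v) IHu // sumn_word_add //; lia.
Qed.

Let gtn_trans : transitive gtn.
Proof. by move=> y x z xy yz; apply: ltn_trans yz xy. Qed.

(** The rearrangement inequality: moving the largest letter n of w to the front
past the letters x of a prefix lowers the weight by the sum of the n - x. *)
Lemma perm_weight (nu w : seq nat) : sorted gtn nu -> perm_eq w nu ->
  w = nu \/ (weight nu < weight w)%N.
Proof.
elim: nu w => [|n nu IHnu] w srt pw.
  by left; apply/nilP; rewrite /nilp (perm_size pw).
have nw : n \in w by rewrite (perm_mem pw) mem_head.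
have [w1 [w2 wE]] : exists w1 w2, w = w1 ++ n :: w2.
  by case/splitPr: nw => w1 w2; exists w1, w2.
have pw' : perm_eq (w1 ++ w2) nu.
  by move: pw; rewrite wE -cat1s perm_catCA perm_cons.
have nu_lt x : x \in nu -> (x < n)%N.
  by move=> xnu; have := order_path_min gtn_trans srt => /allP/(_ x xnu).
have w1lt : all (ltn^~ n) w1.
  by apply/allP => x xw; apply: nu_lt; rewrite -(perm_mem pw') mem_cat xw.
(* The weight lost by moving n to the front. *)
have wt12 : (weight (n :: w1 ++ w2) + sumn [seq (n - x)%N | x <- w1] = weight w)%N.
  rewrite wE; move: w1lt; clear; elim: w1 => [|x w1 IHw] /=; first by rewrite addn0.
  case/andP=> xn /IHw; rewrite /= !sumn_cat /=; lia.
have wtnu : weight (n :: nu) = (sumn nu + weight nu)%N by [].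
have sum12 : sumn (w1 ++ w2) = sumn nu by apply/perm_sumn.
have [w12|lt12] := IHnu _ (path_sorted srt) pw'; last first.
  by right; move: wt12; rewrite /= sum12; lia.
case: w1 wE w1lt wt12 w12 {pw' sum12} => [|x w1] wE w1lt wt12 w12.
  by left; rewrite wE -w12.
right; move: w1lt wt12; rewrite w12 /= => /andP[xn _]; lia.
Qed.

Variable K : fieldType.
Implicit Types (f g : seq nat -> K) (u v w : seq nat).

Lemma conv_support f g w : conv f g w != 0 ->
  exists u v, [/\ size u = size v, w = word_add u v, f u != 0 & g v != 0].
Proof.
elim: w f g => [|n w IHw] f g /=.
  by rewrite mulf_eq0 negb_or => /andP[f0 g0]; exists [::], [::].
case: (boolP [exists i : 'I_n.+1, conv (fun u => f (nat_of_ord i :: u))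
   (fun u => g ((n - i)%N :: u)) w != 0]) => [/existsP[i /IHw]|].
  case=> u [v [uv wE fu gv]] _; exists (nat_of_ord i :: u), ((n - i)%N :: v).
  split=> //=; first by rewrite uv.
  by rewrite wE /word_add /= subnKC ?leq_ord.
move=> /existsPn none; rewrite big1 ?eqxx // => i _; apply/eqP.
by have := none i; rewrite negbK.
Qed.

Definition leading_word f (l : seq nat) :=
  f l = 1 /\ forall w, f w != 0 ->
    [/\ size w = size l, sumn w = sumn l & w = l \/ (weight l < weight w)%N].

(** The coefficient of a monomial in a product is the product of two
coefficients if the monomial factors in one way only. *)
Lemma conv_single_split f g (l m : seq nat) : size l = size m ->
  (forall u v, f u != 0 -> g v != 0 -> size u = size v ->
     word_add u v = word_add l m -> u = l) ->
  conv f g (word_add l m) = f l * g m.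
Proof.
elim: l m f g => [|a l IHl] [|b m] f g //= [slm] single.
rewrite (bigD1 (Ordinal (leq_addr b a : a < (a + b).+1)%N)) //= big1 ?addr0.
  rewrite addKn; apply: IHl => // u v fu gv uv uvE.
  suff [] : a :: u = a :: l by [].
  apply: (single _ (b :: v)) => //=; first by rewrite uv.
  by rewrite /word_add /= -/(word_add u v) uvE.
move=> i /eqP ia; apply/eqP; apply: contraT => /conv_support[u [v [uv wE fu gv]]].
suff [iE] : nat_of_ord i :: u = a :: l by case: ia; apply: val_inj.
apply: (single _ ((a + b - i)%N :: v)) => //=; first by rewrite uv.
by rewrite /word_add /= subnKC ?leq_ord //; congr (_ :: _); exact: esym wE.
Qed.

(** As the weight is additive, the monomial of least weight of a product arises
only from the monomials of least weight of the factors. *)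
Lemma conv_leading_word f g (l m : seq nat) : size l = size m ->
  leading_word f l -> leading_word g m -> leading_word (conv f g) (word_add l m).
Proof.
move=> slm [fl ldf] [gm ldg]; split.
  rewrite conv_single_split ?fl ?gm ?mulr1 // => u v fu gv uv uvE.
  have [su su' [//|wu]] := ldf u fu.
  have [sv sv' wv] := ldg v gv.
  have := congr1 weight uvE; rewrite !weight_word_add //.
  by case: wv => [->|]; lia.
move=> w /conv_support[u [v [uv -> fu gv]]].
have [su su' wu] := ldf u fu; have [sv sv' wv] := ldg v gv.
rewrite !size_word_add // !sumn_word_add // !weight_word_add // su su' sv'; split=> //.
by case: wu => [->|wu]; case: wv => [->|wv];
  [left | right; lia | right; lia | right; lia].
Qed.

Lemma conv_bounded f g a b a' b' :
  (forall w, f w != 0 -> all (fun x => a <= x < b)%N w) ->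
  (forall w, g w != 0 -> all (fun x => a' <= x < b')%N w) ->
  forall w, conv f g w != 0 -> all (fun x => a + a' <= x < (b + b').-1)%N w.
Proof.
move=> bf bg w /conv_support[u [v [uv -> /bf bu /bg bv]]].
elim: u v uv bu bv => [|x u IHu] [|y v] //= [uv] /andP[ax bu] /andP[ay bv].
by rewrite -/(word_add u v) IHu // andbT; lia.
Qed.

Fixpoint inversions (w : seq nat) : nat :=
  if w is x :: w' then (count (ltn x) w' + inversions w')%N else 0%N.

(** For decreasing nu, the coefficients of the determinant of the z_i ^ nu_j. *)
Definition alternating (nu w : seq nat) : K :=
  if perm_eq w nu then (-1) ^+ inversions w else 0.

Lemma alternating_swap nu : uniq nu -> swap_symmetric 1 (alternating nu).
Proof.
move=> unu w i j u; rewrite /alternating expr1 mulN1r.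
have pE : perm_eq (w ++ i :: j :: u) (w ++ j :: i :: u).
  by rewrite perm_cat2l -(cat1s i) -(cat1s j) perm_catCA.
rewrite (permPl pE); case: ifP => pw; last by rewrite oppr0.
have ij : i != j.
  apply/eqP => ij; move: pw; rewrite ij => /perm_uniq; rewrite unu cat_uniq /=.
  by rewrite inE eqxx !andbF.
clear pw; rewrite -[LHS]signr_odd -[X in _ = - X]signr_odd.
suff -> : odd (inversions (w ++ i :: j :: u)) = ~~ odd (inversions (w ++ j :: i :: u)).
  by case: (odd _); rewrite ?expr0 ?expr1 ?opprK.
elim: w pE => [|x w IHw] pE /=.
  by rewrite !oddD; case: ltngtP ij => //= _ _; 
    case: (odd (count (ltn i) u)); case: (odd (count (ltn j) u)); case: (odd _).
have pE' : perm_eq (w ++ i :: j :: u) (w ++ j :: i :: u) by rewrite -(perm_cons x).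
by rewrite !oddD (permP pE') IHw // addbN.
Qed.

(** An alternating polynomial is opposite to itself on the diagonal, where it
must vanish if 2 is invertible. *)
Lemma swap_diagonal_order f : [pchar K] =i pred0 ->
  swap_symmetric 1 f -> diagonal_order 1 f.
Proof.
move=> /pcharf0P charK sf w s [|//] u _.
under eq_bigr do rewrite bin0 mulr1n.
set S := (X in X = 0); have SN : S = - S.
  rewrite {1}/S (reindex_inj rev_ord_inj) -sumrN; apply: eq_bigr => i _ /=.
  by rewrite sf expr1 mulN1r subSS subKn // -ltnS.
apply/eqP; have /eqP : S + S = 0 by rewrite {1}SN addNr.
by rewrite -mulr2n -mulr_natl mulf_eq0 charK.
Qed.

Lemma inversions_sorted nu : sorted gtn nu -> inversions nu = 0%N.
Proof.
elim: nu => [|n nu IHnu] //= srt; rewrite IHnu ?(path_sorted srt) // addn0.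
apply/eqP; rewrite -leqn0 leqNgt -has_count; apply/hasPn => x xnu.
by have := order_path_min gtn_trans srt => /allP/(_ x xnu); rewrite /= -leqNgt => /ltnW.
Qed.

Lemma alternating_leading_word nu : sorted gtn nu -> leading_word (alternating nu) nu.
Proof.
move=> srt; rewrite /alternating; split; first by rewrite perm_refl inversions_sorted.
move=> w; case: ifP => [pw _|]; last by rewrite eqxx.
by split; [apply: perm_size | apply/perm_sumn | apply: perm_weight].
Qed.

Lemma alternating_bounded nu a b : all (fun x => a <= x < b)%N nu ->
  forall w, alternating nu w != 0 -> all (fun x => a <= x < b)%N w.
Proof.
move=> bnu w; rewrite /alternating.
by case: ifP => [pw _|]; rewrite ?eqxx // (perm_all _ pw).
Qed.

End LeadingWords.

(** * Polynomials with a prescribed leading basis word *)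
Section SpacedWords.

Definition spaced (p : nat) : pred (seq nat) := sorted (fun x y => y + p <= x)%N.

Fixpoint staircase (r : nat) : seq nat := if r is r'.+1 then r' :: staircase r' else [::].

(** Subtracting n times a staircase turns gaps of at least n + 1 into gaps of at
least 1, so that the result can serve as exponents of a determinant. *)
Fixpoint compress (n : nat) (l : seq nat) : seq nat :=
  if l is x :: l' then (x - n * size l')%N :: compress n l' else [::].

Lemma size_staircase r : size (staircase r) = r.
Proof. by elim: r => //= r ->. Qed.

Lemma staircase_bounded r : all (fun x => 0 <= x < r)%N (staircase r).
Proof.
elim: r => //= r IHr; rewrite ltnSn /=; apply: sub_all IHr => x /=; lia.
Qed.

Lemma staircase_sorted r : sorted gtn (staircase r).
Proof. by case: r => //= r; elim: r => //= r ->; rewrite ltnSn. Qed.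

Lemma size_compress n l : size (compress n l) = size l.
Proof. by elim: l => //= x l ->. Qed.

Lemma compress0 l : compress 0 l = l.
Proof. by elim: l => //= x l ->; rewrite mul0n subn0. Qed.

Lemma spaced_lower p m x l : spaced p (x :: l) -> all (leq m) (x :: l) ->
  (m + p * size l <= x)%N.
Proof.
elim: l x => [|y l IHl] x /=; first by rewrite muln0 addn0 andbT.
by move=> /andP[yx spl] /andP[_ ml]; have := IHl _ spl ml; rewrite mulnS; lia.
Qed.

Lemma compress_sorted n l : spaced n.+1 l -> sorted gtn (compress n l).
Proof.
case: l => //= x l; elim: l x => //= y l IHl x /andP[yx spl].
apply/andP; split; last exact: IHl.
by have := @spaced_lower _ 0 _ _ spl (all_predT _); rewrite mulnS mulSn; lia.
Qed.

Lemma compress_lower n m l : spaced n.+1 l -> all (leq m) l ->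
  all (leq m) (compress n l).
Proof.
elim: l => //= x l IHl spl ml.
have := spaced_lower spl ml; rewrite mulSn.
case/andP: ml => _ ml low; apply/andP; split; first by lia.
by apply: IHl ml; apply: path_sorted spl.
Qed.

Lemma compress_upper n N l : spaced n.+1 l -> all (ltn^~ N) l ->
  all (fun x => x + n * (size l).-1 < N)%N (compress n l).
Proof.
elim: l N => //= x l IHl N spl /andP[xN lN].
have low := @spaced_lower _ 0 _ _ spl (all_predT _).
apply/andP; split; first by move: low; rewrite mulSn; lia.
case: l IHl spl lN low => // y l IHl /andP[yx spl] lN low.
have := IHl (x - n)%N spl; rewrite /= -/(compress n l).
have yl : all (ltn^~ (x - n)%N) (y :: l).
  rewrite /= (_ : (y < x - n)%N); last by lia.
  apply/allP => z zl /=.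
  have tr : transitive (fun x y => y + n.+1 <= x)%N by move=> b a c /=; lia.
  by have := order_path_min tr spl => /allP/(_ z zl); lia.
move=> /(_ yl) /andP[h1 h2]; rewrite mulnS; apply/andP; split; first by lia.
by apply: sub_all h2 => z /=; lia.
Qed.

Lemma compress_add n q l : (n < q)%N -> spaced q l ->
  word_add (compress n.+1 l) (staircase (size l)) = compress n l.
Proof.
move=> nq; elim: l => //= x l IHl spl.
have low := @spaced_lower _ 0 _ _ spl (all_predT _).
rewrite -[LHS]/((x - n.+1 * size l + size l)%N ::
  word_add (compress n.+1 l) (staircase (size l))) IHl; last exact: path_sorted spl.
congr (_ :: _).
have : (n.+1 * size l <= q * size l)%N by rewrite leq_mul2r nq orbT.
by rewrite mulSn; lia.
Qed.

Variable K : fieldType.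

(** The determinant with exponents l - (p - 1) (r - 1, ..., 1, 0), where r is
the length of l, times the (p - 1)-th power of the Vandermonde determinant. *)
Definition detector (p : nat) (l : seq nat) : seq nat -> K :=
  iter p.-1 (fun f => conv f (alternating K (staircase (size l))))
    (alternating K (compress p.-1 l)).

Lemma detector_leading_word p l :
  spaced p l -> (0 < p)%N -> leading_word (detector p l) l.
Proof.
case: p => // n spl _; rewrite /detector /=.
suff IH i : (i <= n)%N -> leading_word
    (iter i (fun f => conv f (alternating K (staircase (size l))))
      (alternating K (compress n l))) (compress (n - i) l).
  by have := IH n (leqnn n); rewrite subnn compress0.
elim: i => [_|i IHi iltn] /=.
  by rewrite subn0; apply/alternating_leading_word/compress_sorted.
rewrite -(@compress_add (n - i.+1) n.+1) //; last by lia.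
apply: conv_leading_word; first by rewrite size_compress size_staircase.
  by rewrite -subSn // subSS; apply/IHi/ltnW.
exact/alternating_leading_word/staircase_sorted.
Qed.

(** Each Vandermonde factor has degree at most r - 1 in every variable, which is
exactly what the compression of l had removed from the largest letter. *)
Lemma detector_bounded p m N l : (0 < p)%N -> spaced p l ->
  all (leq m) l -> all (ltn^~ N) l ->
  forall w, detector p l w != 0 -> all (fun x => m <= x < N)%N w.
Proof.
case: p => // n _ spl ml lN; rewrite /detector /=.
case: (posnP (size l)) => [/size0nil l0|l_gt0].
  have := @detector_leading_word n.+1 l spl isT.
  rewrite /detector /= => -[_ ld] w /ld[sw _ _].
  by move: sw; rewrite l0 => /size0nil ->.
(* This keeps the truncated subtraction below exact. *)
have Nbig : (n.+1 * (size l).-1 < N)%N.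
  clear ml; case: l spl lN l_gt0 => // x l spl /= /andP[xN _] _.
  by have := @spaced_lower _ 0 _ _ spl (all_predT _); lia.
suff IH i : (i <= n)%N -> forall w,
    iter i (fun f => conv f (alternating K (staircase (size l))))
      (alternating K (compress n l)) w != 0 ->
    all (fun x => m <= x < N - (n - i) * (size l).-1)%N w.
  by have := IH n (leqnn n); rewrite subnn mul0n subn0.
elim: i => [_|i IHi iltn] /=.
  rewrite subn0; apply: alternating_bounded.
  apply/allP => x xl; have /allP/(_ x xl) := compress_lower spl ml.
  by have /allP/(_ x xl) := compress_upper spl lN; lia.
move=> w /(conv_bounded (IHi (ltnW iltn)) (alternating_bounded (staircase_bounded _))).
apply: sub_all => x; rewrite addn0.
have nE : (n - i = (n - i.+1).+1)%N by lia.
have : ((n - i) * (size l).-1 <= n.+1 * (size l).-1)%N by rewrite leq_mul2r; lia.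
by rewrite nE mulSn; lia.
Qed.

Hypothesis charK : [pchar K] =i pred0.

Lemma detector_symmetric p l : (0 < p)%N -> spaced p l ->
  swap_symmetric p (detector p l) /\ diagonal_order p (detector p l).
Proof.
case: p => // n _ spl; rewrite /detector /=.
have gtn_neq : forall s, sorted gtn s -> uniq s.
  move=> s; apply: sorted_uniq => [y x z xy yz|x]; [exact: ltn_trans yz xy | exact: ltnn].
have ucomp := gtn_neq _ (compress_sorted spl).
have ust := gtn_neq _ (staircase_sorted (size l)).
move: (compress n l) ucomp => nu unu; clear spl.
elim: n => [|i [IHs IHd]].
  split; first exact: alternating_swap.
  exact/(swap_diagonal_order charK)/alternating_swap.
rewrite -[i.+2]addn1; split; first exact/conv_swap_symmetric/alternating_swap.
exact/conv_diagonal_order/(swap_diagonal_order charK)/alternating_swap.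
Qed.

End SpacedWords.

(** * The module of admissible arrays *)
Section WordSpace.
Variables (K : fieldType) (p N : nat).

(** The arrays that define linear forms on the algebra generated by
x_0, ..., x_(N-1) subject to supercommutativity and to the divisibility of
a(z) a(w) by (z - w)^p. *)
Definition admissible (f : seq nat -> K) : Prop :=
  [/\ swap_symmetric p f, diagonal_order p f
    & forall w i u, (N <= i)%N -> f (w ++ i :: u) = 0].

Notation array := (seq nat -> K^o).

Fact admissible_subspace : subspace (admissible : array -> Prop).
Proof.
split=> [|c f g [fs fd fN] [gs gd gN]]; first by split=> [w i j u|w s j u _|//];
  [rewrite mulr0 | apply: big1 => i _; rewrite mul0rn].
have E w : (c *: f + g) w = c * f w + g w by [].
split=> [w i j u|w s j u jp|w i u Ni].
- by rewrite !E fs gs mulrDr mulrCA.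
- transitivity (c * (\sum_(i < s.+1) f (w ++ (i : nat) :: (s - i)%N :: u) *+ 'C(i, j)) +
    \sum_(i < s.+1) g (w ++ (i : nat) :: (s - i)%N :: u) *+ 'C(i, j)).
    by rewrite mulr_sumr -big_split; apply: eq_bigr => i _; rewrite E mulrnDl mulrnAr.
  by rewrite fd // gd // mulr0 addr0.
by rewrite E fN // gN // mulr0 addr0.
Qed.

Definition word_space := subspace_sort admissible_subspace.
HB.instance Definition _ := GRing.Lmodule.on word_space.

Definition word_val (f : word_space) : array := \val f.

Lemma word_val_linear : linear word_val. Proof. exact: subspace_val_linear. Qed.
Lemma word_val_inj : injective word_val. Proof. exact: val_inj. Qed.
Lemma word_valP f : admissible (word_val f). Proof. exact: subspace_valP. Qed.

Fact shift_admissible i f : admissible f -> admissible (fun w => f (rcons w i)).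
Proof.
by move=> [fs fd fN]; split=> [w j l u|w s j u jp|w j u Nj];
  [rewrite !rcons_cat /=; apply: fs
  | under eq_bigr do rewrite rcons_cat /=; apply: fd
  | rewrite rcons_cat /=; apply: fN].
Qed.

(** The transpose of right multiplication by x_i; the values of an array f are
recovered as f(w) = (x_(w_0) ... x_(w_(r-1)) f)([::]). *)
Definition word_shift i (f : word_space) : word_space :=
  subspace_in admissible_subspace (shift_admissible i (word_valP f)).

Lemma word_shiftE i f w : word_val (word_shift i f) w = word_val f (rcons w i).
Proof. by []. Qed.

Lemma word_shift_linear : series_linear word_shift.
Proof.
by move=> i c f g; apply: word_val_inj; apply/funext => w.
Qed.

Definition word_par (s : bool) (f : word_space) : Prop :=
  forall w, word_val f w != 0 -> odd (p * size w) = s.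

Lemma word_shift_par s i f : word_par s f -> word_par (odd p (+) s) (word_shift i f).
Proof.
move=> fs w /fs; rewrite size_rcons mulnS oddD => <-.
by rewrite addbA addbb.
Qed.

Lemma word_shift_comm i j f :
  word_shift i (word_shift j f) = (-1) ^+ p *: word_shift j (word_shift i f).
Proof.
apply: word_val_inj; apply/funext => w.
have [fs _ _] := word_valP f.
rewrite !word_shiftE (linZ word_val_linear).
rewrite -[RHS]/((-1) ^+ p * word_val f (rcons (rcons w j) i)).
by rewrite -!cats1 -!catA; apply: fs.
Qed.

Lemma word_shift_rel j s f : (j < p)%N ->
  \sum_(i < s.+1) word_shift i (word_shift (s - i)%N f) *+ 'C(i, j) = 0.
Proof.
move=> jp; apply: word_val_inj; apply/funext => w.
have [_ fd _] := word_valP f.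
rewrite (lin_sum word_val_linear) fct_sumE -[RHS](fd w s j [::] jp).
apply: eq_bigr => i _; rewrite (linMn word_val_linear).
have -> : (w ++ [:: (i : nat); (s - i)%N]) = rcons (rcons w i) (s - i)%N.
  by rewrite -!cats1 -catA.
by elim: 'C(i, j) => // c IHc; rewrite !mulrS -IHc.
Qed.

Lemma word_shift_bound i f : (N <= i)%N -> word_shift i f = 0.
Proof.
move=> Ni; apply: word_val_inj; apply/funext => w.
have [_ _ fN] := word_valP f.
by rewrite word_shiftE -cats1 fN.
Qed.

Lemma word_par_grading : is_grading word_par.
Proof.
apply: is_grading_bool => [s|f|f f0 f1].
- split=> [w|c f g fs gs w]; first by rewrite -[word_val 0 w]/(0 : K) eqxx.
  rewrite word_val_linear => fg; have [fw|fw] := eqVneq (word_val f w) 0; last exact: fs.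
  apply: gs; apply: contra fg => /eqP gw.
  by rewrite -[(_ + _) w]/(c * word_val f w + word_val g w) fw gw mulr0 addr0.
- have [fs fd fN] := word_valP f.
  have restr s : admissible (fun w => if odd (p * size w) == s then word_val f w else 0).
    split=> [w i j u|w l j u jp|w i u Ni].
    + rewrite !size_cat /=; case: ifP => _; last by rewrite mulr0.
      exact: fs.
    + case E : (odd (p * (size w + (size u).+2)) == s).
        by under eq_bigr => i _ do rewrite size_cat /= E; apply: fd.
      by rewrite big1 // => i _; rewrite size_cat /= E mul0rn.
    + by rewrite fN // if_same.
  exists (subspace_in admissible_subspace (restr false)).
  exists (subspace_in admissible_subspace (restr true)).
  split=> [w|w|]; rewrite /word_val /=.
  + by case: ifP => [/eqP|_ /eqP].
  + by case: ifP => [/eqP|_ /eqP].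
  apply: word_val_inj; rewrite (linD word_val_linear); apply/funext => w.
  rewrite -[RHS]/((if odd (p * size w) == false then word_val f w else 0) +
    (if odd (p * size w) == true then word_val f w else 0)).
  by case: (odd _); rewrite ?addr0 ?add0r.
apply: word_val_inj; apply/funext => w; apply/eqP.
rewrite -[X in _ == X]/(0 : K); apply: contraT => fw.
by have := f0 w fw; rewrite (f1 w fw).
Qed.

End WordSpace.

Section QuotientFactor.
Variable K : fieldType.

(** The kernel of q is generated by the modes a_(-k-n), which f kills. For the
parity, an element of Q lifts to a sum of an even and an odd element of F, and
the part of the wrong parity is mapped to zero by q. *)
Lemma quotient_va_factor (k : int) (F Q V : vertexAlg K) (a : F)
    (q : F -> Q) (f : F -> V) :
  is_quotient_va k a q -> va_hom f ->
  (forall (n : nat) u, va_mode V (f a) (- k - n%:Z) u = 0) ->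
  exists g : Q -> V, va_hom g /\ forall x, g (q x) = f x.
Proof.
move=> [[linq qvac qmode qpar] qsurj qker] [linf fvac fmode fpar] fa0.
have fker x : q x = 0 -> f x = 0.
  move=> /qker[n [h ->]]; rewrite (lin_sum linf) big1 // => i _.
  by rewrite fmode fa0.
have [s sK] := choice qsurj.
have fs x : f (s (q x)) = f x.
  apply/eqP; rewrite -subr_eq0 -(linB linf); apply/eqP/fker.
  by rewrite (linB linq) sK subrr.
exists (fun y => f (s y)); split=> //; split.
- move=> c y z; rewrite -[in LHS](sK y) -[in LHS](sK z) -linq fs linf //.
- by rewrite -qvac fs.
- by move=> u n v; rewrite -[in LHS](sK u) -[in LHS](sK v) -qmode fs fmode.
move=> t y ty.
have [x0 [x1 [px0 px1 sE]]] := grading_bool_decomp (s y) (va_par_grading F).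
have par_eq (x x' : F) :
    va_par F t x -> va_par F (~~ t) x' -> s y = x + x' -> f (s y) = f x.
  move=> px px' E; rewrite E (linD linf) (fker x') ?addr0 //.
  have yE : q x' = y - q x by rewrite -(sK y) E (linD linq) [q x + _]addrC addrK.
  have sQ u : subspace (va_par Q u) by case: (va_par_grading Q).
  have p1 : va_par Q t (q x') by rewrite yE; apply: subspaceB => //; apply: qpar.
  have p2 := qpar _ _ px'.
  by case: t {px ty} px' p1 p2 => _ p1 p2;
    apply: (grading_bool_disjoint (va_par_grading Q)).
case: t ty par_eq => ty par_eq.
  by rewrite (par_eq x1 x0) //; [apply: fpar | rewrite addrC].
by rewrite (par_eq x0 x1) //; apply: fpar.
Qed.

End QuotientFactor.

Section WordModule.
Variables (K : fieldType) (p N : nat) (F Fk : vertexAlg K) (aF : F) (q : F -> Fk).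
Hypothesis freeF : is_free_va p aF.
Hypothesis quoF : is_quotient_va N.+1%:Z aF q.

(** F(p) maps to the vertex algebra generated by the series of the operators
x_i, because the latter satisfies the same locality. The modes a_(-k-n) go to
divided derivatives of order at least N of a polynomial of degree less than N,
so the map factors through the quotient. *)
Lemma word_space_representation :
  exists act : Fk -> int -> word_space K p N -> word_space K p N,
  is_representation (va_par Fk) (va_vac Fk) (va_mode Fk) (@word_par K p N) act /\
  forall n f, act (q aF) n f = if n is Negz i then word_shift i f else 0.
Proof.
have [V [b [act [genV repV actb topV]]]] :=
  operator_vertex_algebra (word_par_grading K p N) (@word_shift_linear K p N)
    (@word_shift_par K p N) (@word_shift_comm K p N) (@word_shift_rel K p N)
    (@word_shift_bound K p N).
have [_ /(_ V b genV) [f [homf fa _]]] := freeF.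
have [n u|g [homg gq]] := quotient_va_factor quoF homf.
  by rewrite fa (_ : - N.+1%:Z - n%:Z = Negz (N + n)); [apply/topV/leq_addr | lia].
exists (fun u n x => act (g u) n x); split; last by move=> n x; rewrite gq fa actb.
exact: representation_pullback homg repV.
Qed.

(** The vanishing of the products a_(n) a, n >= - p, is locality on the vacuum:
in its coefficient of w^0 only the term a_(n) a_(-1) 1 is left. *)
Lemma quotient_generator : [/\ va_par Fk (odd p) (q aF),
  forall n : int, - p%:Z <= n -> va_mode Fk (q aF) n (q aF) = 0,
  forall i u, (N <= i)%N -> va_mode Fk (q aF) (Negz i) u = 0
  & va_generated (q aF)].
Proof.
have [[linq qvac qmode qpar] qsurj qker] := quoF.
have [[par loc gen] _] := freeF.
split.
- exact: qpar.
- move=> n pn; rewrite -qmode; suff -> : va_mode F aF n aF = 0 by exact: lin0.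
  (* On the vacuum the modes a_(r-1), r > 0, and a_(n+p+r), r >= 0, vanish. *)
  have [N0 locN] := loc (n + p%:Z) (-1) (va_vac F).
  have := locN N0.+1 (leqnSn _); rewrite [RHS]big1 => [|r _]; last first.
    rewrite va_creation0 ?(lin0 (act_linear_r (va_adjoint F) _ _)) ?mul0rz //; lia.
  rewrite big_ord_recl big1 => [|r _]; last first.
    rewrite [va_mode F aF (-1 + _) _]va_creation0; last by rewrite lift0; lia.
    by rewrite (lin0 (act_linear_r (va_adjoint F) _ _)) mul0rz.
  rewrite -[nat_of_ord ord0]/0%N expr0 binz0 mulr1.
  rewrite (_ : n + p%:Z - p%:Z - 0%:Z = n); last by lia.
  by rewrite mulr1z !addr0 va_creation.
- move=> i u Ni; have [y <-] := qsurj u; rewrite -qmode; apply/qker.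
  exists (i - N).+1, (fun j => if j == (i - N)%N then y else 0).
  rewrite big_ord_recr /= eqxx big1 ?add0r => [|j _].
    by congr va_mode; lia.
  by rewrite ifN ?(lin0 (act_linear_r (va_adjoint F) _ _)) //; have := ltn_ord j; lia.
move=> P sP P1 Pa Pmul v; have [x <-] := qsurj v.
apply: (gen (fun x => P (q x))) => //.
- exact: subspace_preim linq sP.
- by rewrite qvac.
by move=> u n w Pu Pw; rewrite qmode; apply: Pmul.
Qed.

End WordModule.

(** * Modules over a vertex algebra generated by one such element *)
Section GeneratedByOne.
Variables (K : fieldType) (p N : nat) (V : vertexAlg K) (a : V).
Hypothesis charK : [pchar K] =i pred0.
Hypothesis a_par : va_par V (odd p) a.
Hypothesis a_prod : forall n : int, - p%:Z <= n -> va_mode V a n a = 0.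
Hypothesis a_top : forall i u, (N <= i)%N -> va_mode V a (Negz i) u = 0.
Hypothesis a_gen : va_generated a.

Definition adjoint_module : vmodule V := VModule (va_par_grading V) (va_adjoint V).

Section OneModule.
Variable M : vmodule V.
Implicit Types (x y v : M).

Let act_lin u n := vm_act_linear (M := M) u n.
Let act_lin_l n x := vm_act_linear_l (M := M) n x.
Let act0 u n : vm_act M u n 0 = 0 := lin0 (act_lin u n).
Let act0l n x : vm_act M 0 n x = 0 := lin0 (act_lin_l n x).

Lemma bin_neq0 (n j : nat) : (j <= n)%N -> forall x, x *+ 'C(n, j) = 0 -> x = 0.
Proof.
move=> jn x; rewrite -scaler_nat => /eqP; rewrite scaler_eq0.
by move/pcharf0P: charK => ->; rewrite -leqn0 leqNgt bin_gt0 jn /= => /eqP.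
Qed.

(** The element a_(-1-N) 1 is, up to a factorial, the N-th derivative of a. It
is zero, so the coefficients of the N-th derivative of a(z) vanish; the lemma
expresses them through the modes of a. *)
Lemma Borcherds_vacuum l x : exists N0 : nat, forall n : nat, (N0 <= n)%N ->
  \sum_(j < n) (vm_act M a (Negz N - j%:Z) (vm_act M (va_vac V) (l + j%:Z) x)
     - (-1) ^+ N.+1 *: vm_act M (va_vac V) (Negz N + l - j%:Z) (vm_act M a j%:Z x))
    *+ 'C(N + j, j) = 0.
Proof.
have := act_borcherds (vm_representation M) x l 0 (Negz N) a_par (va_vac_even V).
case=> N0 bN; exists N0 => n /bN eqn.
rewrite big1 in eqn => [|[[|j] jn] _]; last 2 first.
- by rewrite addr0 a_top // act0l mul0rz.
- by rewrite /= bin0n mulr0z.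
rewrite [RHS]eqn; apply: eq_bigr => j _; rewrite andbF addn0 !add0r.
by rewrite mulrA -exprMn mulrNN mulr1 expr1n mul1r -pmulrn.
Qed.

Lemma act_vacE n x : vm_act M (va_vac V) n x = if n == -1 then x else 0.
Proof. exact: act_vac (vm_representation M) _ _. Qed.

(** As the N-th derivative of a(z) is zero, a(z) is a polynomial of degree less
than N in z: its coefficients of negative powers vanish, as do those of z^i
for i >= N ([act_top]). *)
Lemma act_nonneg (n : int) x : 0 <= n -> vm_act M a n x = 0.
Proof.
case: n => // j _; have [N0 bN] := Borcherds_vacuum (N + j)%N%:Z x.
have := bN (N0 + j.+1)%N (leq_addr _ _).
have jN : (j < N0 + j.+1)%N by lia.
rewrite (bigD1 (Ordinal jN)) //= big1 ?addr0 => [|i /eqP ij].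
  have e1 : ((N + j)%N%:Z + j%:Z == -1) = false by lia.
  have e2 : (Negz N + (N + j)%N%:Z - j%:Z == -1) by lia.
  rewrite !act_vacE e1 e2 act0.
  move/bin_neq0 => /(_ (leq_addl _ _)); rewrite sub0r => /eqP.
  rewrite oppr_eq0 scaler_eq0 signr_eq0.
  by move=> /= /eqP.
have e1 : ((N + j)%N%:Z + i%:Z == -1) = false by lia.
have e2 : (Negz N + (N + j)%N%:Z - i%:Z == -1) = false.
  by apply/eqP => ji; case: ij; apply: val_inj => /=; lia.
by rewrite !act_vacE e1 e2 act0 scaler0 subr0 mul0rn.
Qed.

Lemma act_top i x : (N <= i)%N -> vm_act M a (Negz i) x = 0.
Proof.
move=> Ni; pose j := (i - N)%N; have [N0 bN] := Borcherds_vacuum (Negz j) x.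
have := bN (N0 + j.+1)%N (leq_addr _ _).
have jN : (j < N0 + j.+1)%N by lia.
rewrite (bigD1 (Ordinal jN)) //= big1 ?addr0 => [|k /eqP kj].
  have e1 : (Negz j + j%:Z == -1) by lia.
  have e2 : (Negz N + Negz j - j%:Z == -1) = false by lia.
  rewrite !act_vacE e1 e2.
  move/bin_neq0 => /(_ (leq_addl _ _)); rewrite scaler0 subr0 => <-; congr vm_act.
  by rewrite /j; lia.
have e1 : (Negz j + k%:Z == -1) = false.
  by apply/eqP => ji; case: kj; apply: val_inj => /=; lia.
have e2 : (Negz N + Negz j - k%:Z == -1) = false by lia.
by rewrite !act_vacE e1 e2 act0 scaler0 subr0 mul0rn.
Qed.

Definition mode_word (ns : seq int) (x : M) : M := foldr (fun n => vm_act M a (- n)) x ns.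
Definition word_act (w : seq nat) (x : M) : M := foldr (fun i => vm_act M a (Negz i)) x w.

Lemma word_act_linear w : linear (word_act w).
Proof.
elim: w => [|i w IHw] c x y //=; by rewrite -act_lin -IHw.
Qed.

Lemma word_act_cat w w' x : word_act (w ++ w') x = word_act w (word_act w' x).
Proof. exact: foldr_cat. Qed.

(** The iterate formula. The second half of the Borcherds identity drops out
since a has no non-negative modes. *)
Lemma act_mode_mul (t : bool) (u : V) n l x : va_par V t u ->
  exists (B : nat) (c : nat -> int),
    vm_act M (va_mode V a n u) l x =
    \sum_(j < B.+1) vm_act M a (n - j%:Z) (vm_act M u (l + j%:Z) x) *~ c j
    /\ c 0%N = 1.
Proof.
move=> ut; have [N0 bN] := act_borcherds (vm_representation M) x l 0 n a_par ut.
exists N0, (fun j => (-1) ^+ j * binz n j); split; last by rewrite binz0.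
have := bN N0.+1 (leqnSn _); rewrite big_ord_recl [X in _ + X]big1 => [|j _]; last first.
  by rewrite /= bin0n mulr0z.
rewrite addr0 -[nat_of_ord ord0]/0%N binz0 mulr1z.
have -> : n + 0%:Z = n by lia.
have -> : l + 0 - 0%:Z = l by lia.
move=> ->; apply: eq_bigr => j _.
have -> : vm_act M a (0 + j%:Z) x = 0 by apply: act_nonneg.
by rewrite act0 scaler0 subr0 (_ : 0 + n - j%:Z = n - j%:Z) // add0r.
Qed.

(** The Borcherds identity for a and a, with n = j - i - 1 >= - p so that its
left side vanishes. With l = - 1 - j and m = - j its first term is x_i x_j x and
all the others are of the form x_(i+r) x_(j-r) x with r > 0: the index of the
second operator decreases until its modes become non-negative and vanish. *)
Lemma straighten (P : M -> Prop) i j x : subspace P -> (i < j + p)%N ->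
  (forall r, (r < j)%N ->
     P (vm_act M a (Negz (i + r.+1)) (vm_act M a (Negz (j - r.+1)) x))) ->
  P (vm_act M a (Negz i) (vm_act M a (Negz j) x)).
Proof.
move=> sP ijp PS; pose n : int := j%:Z - i%:Z - 1.
have [N0 bN] := act_borcherds (vm_representation M) x (- 1 - j%:Z) (- j%:Z) n a_par a_par.
have := bN N0.+1 (leqnSn _); rewrite big1 => [|r _]; last first.
  by rewrite a_prod ?act0l ?mul0rz //; rewrite /n; lia.
have P0 : P 0 by case: sP.
have second (r : nat) :
    P (vm_act M a (n + (- 1 - j%:Z) - r%:Z) (vm_act M a (- j%:Z + r%:Z) x)).
  have [rj|jr] := ltnP r j; last first.
    by rewrite (act_nonneg (n := - j%:Z + r%:Z)) ?act0 //; lia.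
  rewrite (_ : n + (- 1 - j%:Z) - r%:Z = Negz (i + r.+1)); last by rewrite /n; lia.
  by rewrite (_ : - j%:Z + r%:Z = Negz (j - r.+1)); [apply: PS | lia].
have first (r : nat) : (0 < r)%N ->
    P (vm_act M a (- j%:Z + n - r%:Z) (vm_act M a (- 1 - j%:Z + r%:Z) x)).
  case: r => // r _; have [rj|jr] := ltnP r j; last first.
    by rewrite (act_nonneg (n := - 1 - j%:Z + r.+1%:Z)) ?act0 //; lia.
  rewrite (_ : - j%:Z + n - r.+1%:Z = Negz (i + r.+1)); last by rewrite /n; lia.
  by rewrite (_ : - 1 - j%:Z + r.+1%:Z = Negz (j - r.+1)); [apply: PS | lia].
rewrite big_ord_recl -[nat_of_ord ord0]/0%N expr0 binz0 mulr1 mulr1z.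
rewrite (_ : - j%:Z + n - 0%:Z = Negz i); last by rewrite /n; lia.
rewrite (_ : - 1 - j%:Z + 0%:Z = Negz j); last by lia.
move/esym/eqP; rewrite -addrA addr_eq0 => /eqP ->; apply: subspaceN => //.
rewrite addrC; apply: subspaceB => //; last exact: subspaceZ sP (second 0%N).
apply: (subspace_sum _ sP) => r _; apply: (subspaceMz _ sP).
by apply: subspaceB => //; [apply: first; rewrite lift0 | exact: subspaceZ sP (second _)].
Qed.

Lemma mode_word_word_act ns x : mode_word ns x = 0 \/
  exists w, [/\ mode_word ns x = word_act w x, size w = size ns
    & \sum_(n <- ns) n = (sumn w + size w)%N%:Z].
Proof.
elim: ns => [|n ns [IH|[w [IH sw sumw]]]] /=.
- by right; exists [::]; rewrite big_nil.
- by left; rewrite IH act0.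
case E : (- n) => [k|k]; first by left; rewrite act_nonneg.
right; exists (k :: w); split=> /=; first by rewrite IH.
  by rewrite sw.
by rewrite big_cons sumw /=; lia.
Qed.

End OneModule.

Lemma mode_word_par ns :
  va_par V (odd (p * size ns)) (mode_word (M := adjoint_module) ns (va_vac V)).
Proof.
elim: ns => [|n ns IHns] /=; first by rewrite muln0; apply: va_vac_even.
by rewrite mulnS oddD; apply: act_parity (va_adjoint V) _ _ _ _ _ a_par IHns.
Qed.

(** The iterate formula writes every mode of a monomial in the modes of a as a
combination of products of modes of a. *)
Lemma stable_mode_word (M : vmodule V) (P : M -> Prop) ns l x : subspace P ->
  (forall n y, P y -> P (vm_act M a n y)) ->
  P x -> P (vm_act M (mode_word (M := adjoint_module) ns (va_vac V)) l x).
Proof.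
move=> sP Pa; elim: ns l x => [|n ns IHns] l x Px /=.
  by rewrite act_vacE; case: ifP => // _; case: sP.
have [B [c [-> _]]] := act_mode_mul (M := M) (- n) l x (mode_word_par ns).
by apply: (subspace_sum _ sP) => j _; apply/(subspaceMz _ sP)/Pa/IHns.
Qed.

Lemma spanned_modes (u : V) :
  spanned (fun x => exists ns, x = mode_word (M := adjoint_module) ns (va_vac V)) u.
Proof.
set S := spanned _; have sS : subspace S by apply: spanned_subspace.
have S1 : S (va_vac V) by apply: spanned_gen; exists [::].
have Sa n y : S y -> S (va_mode V a n y).
  move=> Sy; apply: (Sy (fun y => S (va_mode V a n y))).
    exact: subspace_preim (vm_act_linear (M := adjoint_module) a n) sS.
  by move=> _ [ns ->]; apply: spanned_gen; exists (- n :: ns); rewrite /= opprK.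
apply: a_gen => // [|{}u n v Su Sv]; first by rewrite -(va_creation a); apply: Sa.
apply: (Su (fun u => S (va_mode V u n v))).
  exact: subspace_preim (vm_act_linear_l (M := adjoint_module) n v) sS.
by move=> _ [ns ->]; apply: (@stable_mode_word adjoint_module S).
Qed.

Lemma spanned_module (M : vmodule V) (v : M) : vm_generated v ->
  forall y, spanned (fun x => exists ns, x = mode_word ns v) y.
Proof.
move=> gen; set S := spanned _; have sS : subspace S by apply: spanned_subspace.
apply: (gen S sS); first by apply: spanned_gen; exists [::].
move=> u n x Sx; apply: (@spanned_modes u (fun u => S (vm_act M u n x))).
  exact: subspace_preim (vm_act_linear_l n x) sS.
move=> _ [ns ->]; apply: (@stable_mode_word M S) => // l y Sy.
apply: (Sy (fun y => S (vm_act M a l y))).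
  exact: subspace_preim (vm_act_linear a l) sS.
by move=> _ [ks ->]; apply: spanned_gen; exists (- l :: ks); rewrite /= opprK.
Qed.

Lemma spaced_last x l y : spaced p (x :: l) -> y \in x :: l -> (last x l <= y)%N.
Proof.
elim: l x y => [|z l IHl] x y /=; first by rewrite inE => _ /eqP ->.
move=> /andP[zx spl]; rewrite inE => /orP[/eqP ->|yl]; last exact: IHl.
by have := IHl z z spl (mem_head _ _); lia.
Qed.

Section Spanning.
Variables (M : vmodule V) (m : nat) (v : M).
Hypothesis v_order : forall i, (i < m)%N -> vm_act M a (Negz i) v = 0.

Definition basis_word (w : seq nat) : bool :=
  [&& spaced p w, all (leq m) w & all (ltn^~ N) w].

(** Letters above the bound N act by zero everywhere. The last letter of a spaced
word is its smallest one and acts first, on v. *)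
Lemma spaced_word_act w : spaced p w -> ~~ basis_word w -> word_act w v = 0.
Proof.
move=> spw; rewrite /basis_word spw /= negb_and => /orP[/allPn[y yw]|/allPn[y yw]].
  rewrite -ltnNge => ym; case: w spw yw => // x w spw yw.
  rewrite lastI -cats1 word_act_cat /= v_order; first exact: lin0 (word_act_linear _).
  exact: leq_ltn_trans (spaced_last spw yw) ym.
rewrite -leqNgt => Ny; case/splitPr: yw => w1 w2; rewrite word_act_cat /=.
by rewrite act_top // (lin0 (word_act_linear w1)).
Qed.

Lemma weight_move w1 i j w2 r : (r < j)%N ->
  (weight (w1 ++ (i + r.+1)%N :: (j - r.+1)%N :: w2) < weight (w1 ++ i :: j :: w2))%N.
Proof.
move=> rj; suff [] : (weight (w1 ++ (i + r.+1)%N :: (j - r.+1)%N :: w2) <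
    weight (w1 ++ i :: j :: w2))%N /\
    sumn (w1 ++ (i + r.+1)%N :: (j - r.+1)%N :: w2) = sumn (w1 ++ i :: j :: w2) by [].
elim: w1 => [|x w1 [IH1 IH2]] /=; first by split; lia.
by rewrite IH2; split=> //; lia.
Qed.

Lemma unspaced_split w : ~~ spaced p w ->
  exists w1 i j w2, w = w1 ++ i :: j :: w2 /\ (i < j + p)%N.
Proof.
case: w => // x w; elim: w x => // y w IHw x /=.
rewrite negb_and -ltnNge => /orP[xy|/IHw[w1 [i [j [w2 [-> ij]]]]]].
  by exists [::], x, y, w.
by exists (x :: w1), i, j, w2.
Qed.

(** A word that is not spaced contains adjacent letters i, j with i < j + p, and
[straighten] replaces it by words of smaller weight. *)
Lemma word_act_straighten (P : M -> Prop) w : subspace P ->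
  (forall w', basis_word w' -> P (word_act w' v)) -> P (word_act w v).
Proof.
move=> sP; have [n] := ubnP (weight w); elim: n w => // n IHn w wn PB.
have [spw|/unspaced_split[w1 [i [j [w2 [wE ij]]]]]] := boolP (spaced p w).
  have [bw|/(spaced_word_act spw) ->] := boolP (basis_word w); first exact: PB.
  by case: sP.
rewrite wE word_act_cat /=.
apply: (straighten (P := fun y => P (word_act w1 y)) _ ij) => [|r rj].
  exact: subspace_preim (word_act_linear w1) sP.
have wlt := weight_move w1 i w2 rj.
rewrite -[vm_act _ _ _ _]/(word_act [:: (i + r.+1)%N, (j - r.+1)%N & w2] v) -word_act_cat.
by apply: IHn => //; apply: leq_trans wlt _; rewrite -wE -ltnS.
Qed.

(** The linear forms that a universal property will supply, one for each basis
word. *)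
Definition detected : Prop := forall l, basis_word l ->
  exists phi : M -> K^o, linear phi /\ forall w, phi (word_act w v) = detector K p l w.

Hypothesis v_gen : vm_generated v.

Lemma spanned_basis_words y :
  spanned (fun x => exists w, basis_word w /\ x = word_act w v) y.
Proof.
apply: (spanned_module v_gen y); first exact: spanned_subspace.
set S := spanned _; have sS : subspace S by apply: spanned_subspace.
move=> _ [ns ->]; have [->|[w [-> _ _]]] := mode_word_word_act ns v; first by case: sS.
apply: word_act_straighten => // w' bw'.
by apply: spanned_gen; exists w'.
Qed.

End Spanning.

Lemma spanned_combination (U : lmodType K) (I : eqType) (Q : pred I) (e : I -> U) y :
  spanned (fun x => exists i, Q i /\ x = e i) y ->
  exists (s : seq I) (c : I -> K), [/\ uniq s, all Q s & y = \sum_(i <- s) c i *: e i].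
Proof.
pose P y := exists (s : seq I) (c : I -> K),
  [/\ uniq s, all Q s, (forall i, i \notin s -> c i = 0) & y = \sum_(i <- s) c i *: e i].
move=> Sy; suff [s [c [us Qs _ ->]]] : P y by exists s, c.
apply: Sy => [|_ [i [Qi ->]]]; last first.
  exists [:: i], (fun j => (j == i)%:R); split=> //=; first by rewrite Qi.
    by move=> j; rewrite inE => /negbTE ->.
  by rewrite big_seq1 eqxx scale1r.
split; first by exists [::], (fun _ => 0); rewrite big_nil.
move=> b x z [s [c [us Qs c0 ->]]] [t [d [ut Qt d0 ->]]].
pose st := undup (s ++ t).
have ust : uniq st by apply: undup_uniq.
have extend r f : uniq r -> {subset r <= st} -> (forall i, i \notin r -> f i = 0 :> K) ->
    \sum_(i <- r) f i *: e i = \sum_(i <- st) f i *: e i.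
  move=> ur rst f0; rewrite [RHS](bigID (mem r)) /= addrC.
  rewrite [X in _ = X + _]big1 ?add0r => [|i ir]; last by rewrite f0 ?scale0r.
  rewrite -[RHS]big_filter; apply: perm_big; apply: uniq_perm => //.
    exact: filter_uniq.
  by move=> i; rewrite mem_filter; case ir: (i \in r); rewrite //= (rst _ ir).
have sst : {subset s <= st} by move=> i si; rewrite mem_undup mem_cat si.
have tst : {subset t <= st} by move=> i ti; rewrite mem_undup mem_cat ti orbT.
exists st, (fun i => b * c i + d i); split=> //.
- apply/allP => i; rewrite mem_undup mem_cat => /orP[].
    exact: (allP Qs).
  exact: (allP Qt).
- move=> i; rewrite mem_undup mem_cat negb_or => /andP[/c0 -> /d0 ->].
  by rewrite mulr0 addr0.
rewrite (extend s c) // (extend t d) // scaler_sumr -big_split; apply: eq_bigr => i _.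
by rewrite scalerDl scalerA.
Qed.

Lemma max_weight (s : seq (seq nat)) : s != [::] ->
  exists2 l, l \in s & forall w, w \in s -> (weight w <= weight l)%N.
Proof.
elim: s => // x s IHs _; have [->|/IHs[l ls lmax]] := eqVneq s [::].
  by exists x; rewrite ?mem_head // => w; rewrite inE => /eqP ->.
have [xl|lx] := leqP (weight x) (weight l).
  by exists l => [|w]; rewrite inE ?ls ?orbT // => /orP[/eqP ->|/lmax].
exists x => [|w]; rewrite inE ?eqxx // => /orP[/eqP ->//|/lmax wl].
exact: leq_trans wl (ltnW lx).
Qed.

(** In a linear combination y of the e w, the coefficient of a word l of maximal
weight is phi y, for the form phi attached to l: all other words on which phi
does not vanish are heavier than l. *)
Lemma triangular_separation (U : lmodType K) (B : pred (seq nat)) (e : seq nat -> U) y :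
  spanned (fun x => exists w, B w /\ x = e w) y ->
  (forall l, B l -> exists phi : U -> K^o,
    [/\ linear phi, phi (e l) = 1,
        forall w, B w -> phi (e w) != 0 -> w = l \/ (weight l < weight w)%N
      & phi y = 0]) ->
  y = 0.
Proof.
move=> /spanned_combination[s [c [us bs ->]]].
have [n] := ubnP (size s); elim: n s us bs => // n IHn s us bs sn sep.
have [->|/max_weight[l ls lmax]] := eqVneq s [::]; first by rewrite big_nil.
have cl : c l = 0.
  have [phi [linphi phil ld y0]] := sep l (allP bs _ ls).
  move: y0; rewrite (lin_sum linphi) (bigD1_seq l) //=.
  rewrite (linZ linphi) phil big_seq_cond big1 ?addr0 => [|w /andP[ws wl]].
    by rewrite -[_ *: _]/(c l * 1) mulr1.
  rewrite (linZ linphi) -[LHS]/(c w * phi (e w)).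
  have [->|/(ld _ (allP bs _ ws))[/eqP|lw]] := eqVneq (phi (e w)) 0; first exact: mulr0.
    by rewrite (negbTE wl).
  by have := lmax w ws; rewrite leqNgt lw.
have sumE : \sum_(i <- s) c i *: e i = \sum_(i <- rem l s) c i *: e i.
  by rewrite (perm_big _ (perm_to_rem ls)) big_cons cl scale0r; exact: add0r.
rewrite sumE; apply: IHn; first exact: rem_uniq.
- by apply/allP => w /mem_rem; apply: (allP bs).
- by rewrite size_rem //; move: sn; case: (s) ls => //= ? ? _; rewrite ltnS.
by rewrite -sumE.
Qed.

Lemma basis_detector (M : vmodule V) m (v : M) l (phi : M -> K^o) :
  (0 < p)%N -> basis_word m l -> (forall w, phi (word_act w v) = detector K p l w) ->
  phi (word_act l v) = 1 /\ forall w, phi (word_act w v) != 0 ->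
    [/\ size w = size l, sumn w = sumn l & w = l \/ (weight l < weight w)%N].
Proof.
move=> p0 /and3P[spl _ _] phiE; have [dl ld] := detector_leading_word K spl p0.
by rewrite phiE; split=> // w; rewrite phiE; apply: ld.
Qed.

Section Bidegree.
Variables (M : vmodule V) (m : nat) (v : M) (C D S E : K).
Hypothesis v_order : forall i, (i < m)%N -> vm_act M a (Negz i) v = 0.
Hypothesis p_gt0 : (0 < p)%N.
Hypothesis det : detected m v.
Hypothesis v_gen : vm_generated v.

Notation G := (bidegree (vm_act M) a v C D S E).

Definition mode_bidegree (ns : seq int) : K * K :=
  (S + C * (size ns)%:R,
   E + (\sum_(n <- ns) n)%:~R - (size ns)%:R + (size ns)%:R * D).

Lemma bidegree_mode_word ns : G (mode_bidegree ns) (mode_word ns v).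
Proof. by apply: spanned_gen; exists ns. Qed.

Lemma bidegree_subspace cd : subspace (G cd).
Proof. exact: spanned_subspace. Qed.

(** A detector is homogeneous: it only sees words with the length and the sum of
letters of l. *)
Lemma bidegree_detector l (phi : M -> K^o) cd x : basis_word m l -> linear phi ->
  (forall w, phi (word_act w v) = detector K p l w) ->
  G cd x -> cd <> mode_bidegree [seq i.+1%:Z | i <- l] -> phi x = 0.
Proof.
move=> bl linphi phiE Gx ncd; apply: (Gx (fun x => phi x = 0)).
  exact: (subspace_preim linphi (@subspace_eq0 K K^o)).
move=> _ [ns [-> cd1 cd2]]; apply/eqP; apply: contra_notT ncd => nz.
have [nz0|[w [wE sw sumw]]] := mode_word_word_act ns v.
  by rewrite -/(mode_word ns v) nz0 (lin0 linphi) eqxx in nz.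
rewrite -/(mode_word ns v) wE in nz.
have [_ /(_ _ nz) [swl sumwl _]] := basis_detector p_gt0 bl phiE.
have sl : \sum_(n <- [seq i.+1%:Z | i <- l]) n = (sumn l + size l)%N%:Z.
  by elim: (l) => [|i l' IHl] /=; rewrite ?big_nil // big_cons IHl; lia.
rewrite [cd]surjective_pairing cd1 cd2 /mode_bidegree sl size_map sumw -sw swl sumwl.
by [].
Qed.

(** The sum of the subspaces is direct because the form attached to a basis word
vanishes on all of them but one, so that it takes the same value on a vanishing
sum and on a single summand. *)
Lemma bidegree_grading : is_grading G.
Proof.
split=> [|y|s f us Gf sf0 i si]; first exact: bidegree_subspace.
  have sy : spanned (fun x => exists ns, predT ns /\ x = mode_word ns v) y.
    move=> P sP PX; apply: (@spanned_module _ v v_gen y P sP) => _ [ns ->].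
    by apply: PX; exists ns.
  have [t [c [ut _ ->]]] := spanned_combination sy.
  exists (undup (map mode_bidegree t)), (fun cd => \sum_(ns <- t | mode_bidegree ns == cd)
     c ns *: mode_word ns v); split.
    move=> cd; apply: (subspace_sum _ (bidegree_subspace cd)) => ns /eqP <-.
    apply: (@subspaceZ _ _ (G (mode_bidegree ns))); first exact: bidegree_subspace.
    exact: bidegree_mode_word.
  rewrite (exchange_big_dep predT) //= big_seq_cond [RHS]big_seq_cond.
  apply: eq_bigr => ns /andP[nst _]; rewrite -big_filter.
  rewrite (eq_filter (a2 := pred1 (mode_bidegree ns))) => [|cd]; last exact: eq_sym.
  by rewrite filter_pred1_uniq ?undup_uniq ?big_seq1 // mem_undup map_f.
have dec w : basis_word m w -> exists phi : M -> K^o, [/\ linear phi,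
    forall w', phi (word_act w' v) = detector K p w w' & phi (f i) = 0].
  move=> bw; have [phi [linphi phiE]] := det bw; exists phi; split=> //.
  have [ie|ni] := eqVneq i (mode_bidegree [seq i.+1%:Z | i <- w]); last first.
    by apply: (bidegree_detector bw linphi phiE (Gf i)); apply/eqP.
  have := congr1 phi sf0; rewrite (lin0 linphi) (lin_sum linphi) (bigD1_seq i) //=.
  rewrite big1 ?addr0 // => j ji; apply: (bidegree_detector bw linphi phiE (Gf j)).
  by rewrite -ie; apply/eqP.
apply: (triangular_separation (spanned_basis_words v_order v_gen (f i))) => l bl.
have [phi [linphi phiE phi0]] := dec l bl; exists phi.
have [phil ld] := basis_detector p_gt0 bl phiE.
by split=> // w _ /ld[].
Qed.

Lemma bidegree_mode cd (n : int) x : G cd x ->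
  G (cd.1 + C, cd.2 + n%:~R - 1 + D) (vm_act M a (- n) x).
Proof.
move=> Gx; apply: (Gx (fun x => G _ (vm_act M a (- n) x))).
  exact: subspace_preim (vm_act_linear a (- n)) (bidegree_subspace _).
move=> _ [ns [-> cd1 cd2]]; apply: spanned_gen; exists (n :: ns); split=> //=.
  by rewrite cd1 -addn1 natrD; ring.
by rewrite cd2 big_cons intrD -addn1 natrD; ring.
Qed.

(** Monomials in the modes of a suffice, and for them the iterate formula reduces
the claim to the modes of a itself. *)
Lemma bidegree_act : forall (b c : K * K) (u : V) (n : int) (x : M),
  va_bidegree a C D b u -> G c x ->
  G (b.1 + c.1, b.2 + c.2 - n%:~R - 1) (vm_act M u n x).
Proof.
move=> b c u n x Gu Gx; apply: (Gu (fun u => G _ (vm_act M u n x))).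
  exact: subspace_preim (vm_act_linear_l n x) (bidegree_subspace _).
move=> _ [ns [-> -> ->]]; elim: ns n {u Gu} => [|k ns IHns] n /=.
  rewrite act_vacE; case: eqP => [->|_]; last exact: (proj1 (bidegree_subspace _)).
  rewrite big_nil (_ : (_, _) = c) // [c in RHS]surjective_pairing.
  by rewrite intrN; congr pair; ring.
have [B [d [-> _]]] := act_mode_mul (M := M) (- k) n x (mode_word_par ns).
apply: (subspace_sum _ (bidegree_subspace _)) => j _.
apply: (subspaceMz _ (bidegree_subspace _)).
have := @bidegree_mode _ (k + j%:Z) _ (IHns (n + j%:Z)); rewrite opprD.
congr (G _ _); rewrite /= big_cons -[(size ns).+1]addn1 natrD !intrD.
by congr pair; ring.
Qed.

Lemma bidegree_bigraded : is_bigraded_vm (va_bidegree a C D) G.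
Proof. by split; [apply: bidegree_grading | apply: bidegree_act]. Qed.

End Bidegree.

End GeneratedByOne.

(** * The exact sequence *)
Section FreeRepresentations.
Variables (K : fieldType) (p N : nat) (F Fk : vertexAlg K) (aF : F) (q : F -> Fk).
Hypothesis charK : [pchar K] =i pred0.
Hypothesis p_gt0 : (0 < p)%N.
Hypothesis freeF : is_free_va p aF.
Hypothesis quoF : is_quotient_va N.+1%:Z aF q.
Local Notation a := (q aF).

Let a_par : va_par Fk (odd p) a. Proof. by case: (quotient_generator freeF quoF). Qed.
Let a_prod (n : int) : - p%:Z <= n -> va_mode Fk a n a = 0.
Proof. by case: (quotient_generator freeF quoF) => _ + _ _; apply. Qed.
Let a_top i u : (N <= i)%N -> va_mode Fk a (Negz i) u = 0.
Proof. by case: (quotient_generator freeF quoF) => _ _ + _; apply. Qed.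
Let a_gen : va_generated a. Proof. by case: (quotient_generator freeF quoF). Qed.

Lemma detector_vector m l : basis_word p N m l ->
  exists f : word_space K p N, [/\ forall w, word_val f w = detector K p l w,
    word_par (odd (p * size l)) f & forall i, (i < m)%N -> word_shift i f = 0].
Proof.
move=> /and3P[spl ml lN].
have [ds dd] := detector_symmetric charK p_gt0 spl.
have bd := detector_bounded p_gt0 spl ml lN.
have [_ ld] := detector_leading_word K spl p_gt0.
have adm : admissible p N (detector K p l).
  split=> // w i u Ni; apply/eqP; apply: contraT => /bd.
  by rewrite all_cat /= ltnNge Ni !andbF.
exists (subspace_in (admissible_subspace K p N) adm); split=> //.
  by move=> w /ld[->].
move=> i im; apply: word_val_inj; apply/funext => w; apply/eqP.
apply: contraT; rewrite word_shiftE -[word_val _ _]/(detector K p l (rcons w i)) => /bd.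
by rewrite all_rcons leqNgt im.
Qed.

Lemma word_shift_foldr (f : word_space K p N) w u :
  word_val (foldr (@word_shift K p N) f w) u = word_val f (u ++ w).
Proof.
elim: w u => [|i w IHw] u /=; first by rewrite cats0.
by rewrite word_shiftE IHw cat_rcons.
Qed.

Lemma word_eval_linear u : linear (fun f : word_space K p N => word_val f u : K^o).
Proof. by move=> c f g; rewrite word_val_linear. Qed.

(** The array of the detector generates a module with the same annihilation
property as v, so it receives a morphism from M; the form is the value of the
image at the empty word. *)
Lemma free_rep_detected (m : nat) (M : vmodule Fk) (v : M) :
  is_free_rep a m%:Z v -> detected p N a m v.
Proof.
move=> [_ freeM] l bl; have [f [fE fpar f0]] := detector_vector bl.
have [act [rep actE]] := word_space_representation freeF quoF.
pose W : vmodule Fk := VModule (word_par_grading K p N) rep.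
have [Nm [i [w' [[lini inji] iact ipar iw' gen']]]] :=
  @submodule_generated K Fk W _ f fpar.
have [] := freeM Nm w'.
  split=> //; first by exists (odd (p * size l)); apply/ipar; rewrite iw'.
  move=> n n0; apply: inji; rewrite iact iw' (lin0 lini) [LHS]actE.
  case E : (- m%:Z + n) => [//|j]; apply: f0; lia.
move=> h [[[linh hact _] hv _] _].
exists (fun x => word_val (i (h x) : word_space K p N) [::] : K^o); split.
  by move=> c x y; rewrite linh lini; exact: word_eval_linear.
move=> w; rewrite -fE -[w in RHS]/([::] ++ w) -word_shift_foldr; congr (word_val _ _).
elim: w => [|j w IHw] /=; first by rewrite hv iw'.
by rewrite hact iact -IHw; exact: actE.
Qed.

(** F(k,p) carries a universal property as an algebra, not as a module; here the
form is u |-> (u_(-1) f)([::]), which reads monomials like a morphism of modules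
since the elements u have no non-negative modes. *)
Lemma vacuum_detected : detected p N a 0 (va_vac Fk : adjoint_module Fk).
Proof.
move=> l bl; have [f [fE fpar f0]] := detector_vector bl.
have [act [rep actE]] := word_space_representation freeF quoF.
pose W : vmodule Fk := VModule (word_par_grading K p N) rep.
exists (fun u => word_val (act u (-1) f : word_space K p N) [::] : K^o); split.
  by move=> c u u'; rewrite (act_linear_l rep); exact: word_eval_linear.
move=> w; rewrite -fE -[w in RHS]/([::] ++ w) -word_shift_foldr; congr (word_val _ _).
pose u w := word_act a w (va_vac Fk : adjoint_module Fk).
have upar w' : va_par Fk (odd (p * size w')) (u w').
  elim: w' => [|j w' IHw'] /=; first by rewrite muln0; apply: va_vac_even.
  by rewrite mulnS oddD; apply: act_parity (va_adjoint Fk) _ _ _ _ _ a_par IHw'.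
(* This is [act_nonneg] for monomials instead of the generator. *)
have unonneg w' (n : int) x : 0 <= n -> vm_act W (u w') n x = 0.
  elim: w' n x => [|j w' IHw'] n x n0; first by rewrite act_vacE; case: n n0.
  have [B [c [-> _]]] := act_mode_mul charK a_par a_top (Negz j) n (x : W) (upar w').
  rewrite big1 // => k _; rewrite IHw' ?(lin0 (vm_act_linear _ _)) ?mul0rz //.
  by apply: addr_ge0.
elim: w => [|j w IHw]; first exact: (act_vac rep).
have [B [c [E c0]]] := act_mode_mul charK a_par a_top (Negz j) (-1) (f : W) (upar w).
rewrite [LHS]E big_ord_recl c0 mulr1z big1 ?addr0 => [|k _]; last first.
  by rewrite lift0 unonneg ?(lin0 (vm_act_linear _ _)) ?mul0rz //; lia.
by rewrite [vm_act W _ (-1) _]IHw; exact: actE.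
Qed.

Lemma order_vector (m : nat) (M : vmodule Fk) (v : M) :
  (forall n : int, 0 <= n -> vm_act M a (- m%:Z + n) v = 0) <->
  (forall i, (i < m)%N -> vm_act M a (Negz i) v = 0).
Proof.
split=> H => [i im|n n0].
  by rewrite (_ : Negz i = - m%:Z + (m - i.+1)%:Z) ?H //; lia.
case E : (- m%:Z + n) => [j|j]; last by apply: H; lia.
exact: (act_nonneg charK a_par a_top).
Qed.

Lemma adjoint_vacuum_generated : vm_generated (va_vac Fk : adjoint_module Fk).
Proof. by move=> P sP P1 Pmul u; rewrite -(va_creation u); apply: Pmul. Qed.

Lemma generated_eq (M M' : vmodule Fk) (v : M) (f g : M -> M') :
  vm_generated v -> linear f -> linear g ->
  (forall u n x, f (vm_act M u n x) = vm_act M' u n (f x)) ->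
  (forall u n x, g (vm_act M u n x) = vm_act M' u n (g x)) ->
  f v = g v -> f =1 g.
Proof.
move=> gen lf lg fact gact fg; apply: (gen (fun x => f x = g x)) => //.
  exact: subspace_eq.
by move=> u n x E; rewrite fact gact E.
Qed.

Lemma hom_mode_word (M M' : vmodule Fk) (f : M -> M') ns x :
  (forall u n x, f (vm_act M u n x) = vm_act M' u n (f x)) ->
  f (mode_word a ns x) = mode_word a ns (f x).
Proof. by move=> fact; elim: ns => //= n ns IH; rewrite fact IH. Qed.

Lemma hom_word_act (M M' : vmodule Fk) (f : M -> M') w x :
  (forall u n x, f (vm_act M u n x) = vm_act M' u n (f x)) ->
  f (word_act a w x) = word_act a w (f x).
Proof. by move=> fact; elim: w => //= i w IH; rewrite fact IH. Qed.

Lemma weight_rcons w z : weight (rcons w z) = (weight w + z * size w)%N.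
Proof.
elim: w => [|x w IHw] /=; first by rewrite muln0.
by rewrite IHw sumn_rcons mulnS; lia.
Qed.

Lemma basis_word_rcons m l : (m < N)%N -> basis_word p N (m + p) l ->
  basis_word p N m (rcons l m).
Proof.
move=> mN /and3P[spl ml lN]; apply/and3P; split.
- case: l spl ml {lN} => // x l spl ml; have last_m := allP ml _ (mem_last x l).
  by rewrite /spaced /= rcons_path; apply/andP.
- by rewrite all_rcons leqnn; apply: sub_all ml => x /=; lia.
by rewrite all_rcons /= mN.
Qed.


Section ExactSequence.
Variables (m : nat) (M0 M1 Mp : vmodule Fk) (v0 : M0) (v1 : M1) (vp : Mp).
Hypothesis mN : (m < N)%N.
Hypothesis free0 : is_free_rep a m%:Z v0.
Hypothesis free1 : is_free_rep a m.+1%:Z v1.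
Hypothesis freep : is_free_rep a (m + p)%N%:Z vp.

Let ord0 : forall i, (i < m)%N -> vm_act M0 a (Negz i) v0 = 0.
Proof. by case: free0 => -[_ /order_vector]. Qed.
Let ord1 : forall i, (i < m.+1)%N -> vm_act M1 a (Negz i) v1 = 0.
Proof. by case: free1 => -[_ /order_vector]. Qed.
Let ordp : forall i, (i < m + p)%N -> vm_act Mp a (Negz i) vp = 0.
Proof. by case: freep => -[_ /order_vector]. Qed.
Let gen0 : vm_generated v0. Proof. by case: free0 => -[]. Qed.
Let gen1 : vm_generated v1. Proof. by case: free1 => -[]. Qed.
Let genp : vm_generated vp. Proof. by case: freep => -[]. Qed.

Lemma projection_exists :
  exists pi : M0 -> M1, unique_vm_hom v0 v1 pi /\ forall y, exists x, pi x = y.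
Proof.
case: free0 => _; apply; split=> //; first by case: free1 => -[].
by apply/order_vector => i im; apply: ord1; rewrite ltnW.
Qed.

(** The vector x_m v0 does not generate M0, so the universal property is applied
to the submodule that it generates. It is annihilated by x_j for j < m + p:
straightening x_j x_m yields products x_(j+r) x_(m-r) with r > 0, and x_(m-r)
kills v0. *)
Lemma inclusion_exists :
  exists iota : Mp -> M0, unique_vm_hom vp (vm_act M0 a (Negz m) v0) iota.
Proof.
have [[[s v0s] _ _] _] := free0.
have ws : vm_par M0 (odd p (+) s) (vm_act M0 a (Negz m) v0).
  exact: act_parity (vm_representation M0) _ _ _ _ _ a_par v0s.
have [Nm [i [w [[lini inji] iact ipar iw genw]]]] := submodule_generated ws.
have [_ /(_ Nm w)[|f [[[linf fact [e fpar]] fv _] _]]] := freep.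
  split=> //; first by exists (odd p (+) s); apply/ipar; rewrite iw.
  apply/order_vector => j jmp; apply: inji; rewrite iact iw (lin0 lini).
  apply: (straighten charK a_par a_prod a_top (@subspace_eq0 K M0)) => // r rm.
  by rewrite ord0 ?(lin0 (vm_act_linear _ _)) //; lia.
exists (fun x => i (f x)); have homif : vm_hom (fun x => i (f x)).
  split; first by move=> c x y; rewrite linf lini.
    by move=> u n x; rewrite fact iact.
  by exists e => t x /fpar /ipar.
split; rewrite ?fv // => g [ling gact _] gv.
have [linif ifact _] := homif.
by apply: (generated_eq genp) => //; rewrite gv fv.
Qed.

Variables (iota : Mp -> M0) (pi : M0 -> M1).
Hypothesis iota_hom : unique_vm_hom vp (vm_act M0 a (Negz m) v0) iota.
Hypothesis pi_hom : unique_vm_hom v0 v1 pi.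

Let iota_lin : linear iota. Proof. by case: iota_hom => -[]. Qed.
Let pi_lin : linear pi. Proof. by case: pi_hom => -[]. Qed.
Let iota_act u n x : iota (vm_act Mp u n x) = vm_act M0 u n (iota x).
Proof. by case: iota_hom => -[]. Qed.
Let pi_act u n x : pi (vm_act M0 u n x) = vm_act M1 u n (pi x).
Proof. by case: pi_hom => -[]. Qed.
Let iota_v : iota vp = vm_act M0 a (Negz m) v0. Proof. by case: iota_hom. Qed.
Let pi_v : pi v0 = v1. Proof. by case: pi_hom. Qed.

Lemma iota_word w : iota (word_act a w vp) = word_act a (rcons w m) v0.
Proof. by rewrite hom_word_act // iota_v -cats1 word_act_cat. Qed.

(** The image under iota of a basis word for m + p is a basis word for m with a
letter m appended, and appending a letter to words of equal length shifts their
weights by the same amount. So the forms on M0 separate the points of Mp. *)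
Lemma iota_injective : injective iota.
Proof.
suff ker0 y : iota y = 0 -> y = 0.
  move=> x y xy; apply/eqP; rewrite -subr_eq0; apply/eqP/ker0.
  by rewrite (linB iota_lin) xy subrr.
move=> iy0; have sy := spanned_basis_words charK a_par a_prod a_top a_gen ordp genp y.
apply: (triangular_separation sy) => l bl.
have blm := basis_word_rcons mN bl.
have [phi [linphi phiE]] := free_rep_detected free0 blm.
have [phil ld] := basis_detector p_gt0 blm phiE.
exists (fun x => phi (iota x)); split.
- by move=> c x x'; rewrite iota_lin linphi.
- by rewrite iota_word.
- move=> w _; rewrite iota_word => /ld[]; rewrite !size_rcons => -[swl] _ [/rcons_inj[]|].
    by left.
  by rewrite !weight_rcons swl ltn_add2r; right.
by rewrite iy0 (lin0 linphi).
Qed.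

Lemma pi_iota x : pi (iota x) = 0.
Proof.
apply: (generated_eq genp (f := fun x => pi (iota x)) (g := fun _ => 0)).
- by move=> c y z; rewrite iota_lin pi_lin.
- by move=> c y z; rewrite scaler0 addr0.
- by move=> u n y; rewrite iota_act pi_act.
- by move=> u n y; rewrite (lin0 (vm_act_linear _ _)).
by rewrite iota_v pi_act pi_v ord1.
Qed.

(** A basis word for m either ends with m, and is then in the image of iota, or
is a basis word for m + 1. The words of the second kind stay independent in
M1. *)
Lemma kernel_pi y : pi y = 0 -> exists x, iota x = y.
Proof.
move=> piy0.
pose T := spanned (fun x => exists w, basis_word p N m.+1 w /\ x = word_act a w v0).
have sT : subspace T by apply: spanned_subspace.
have [x [z [Tz yE]]] : exists x z, T z /\ y = iota x + z.
  have sy := spanned_basis_words charK a_par a_prod a_top a_gen ord0 gen0 y.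
  apply: (sy (fun y => exists x z, T z /\ y = iota x + z)).
    split; first by exists 0, 0; rewrite (lin0 iota_lin) addr0; split=> //; case: sT.
    move=> c _ _ [x [z [Tz ->]]] [x' [z' [Tz' ->]]].
    exists (c *: x + x'), (c *: z + z'); rewrite iota_lin scalerDr addrACA.
    by split=> //; case: sT => _; apply.
  move=> _ [w [bw ->]]; have [bw1|nbw] := boolP (basis_word p N m.+1 w).
    exists 0, (word_act a w v0); rewrite (lin0 iota_lin) add0r; split=> //.
    by apply: spanned_gen; exists w.
  (* Some letter is at most m, and the last letter is the smallest one. *)
  have [w' wE] : exists w', w = rcons w' m.
    have /and3P[spw mw wN] := bw; move: nbw; rewrite /basis_word spw wN andbT /=.
    case: w spw mw {bw wN} => // x w spw mw /allPn[k kw km].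
    exists (belast x w); rewrite lastI; congr rcons.
    have := spaced_last spw kw; have := allP mw _ (mem_last x w).
    by move: km => /=; lia.
  exists (word_act a w' vp), 0; rewrite iota_word -wE addr0; split=> //; case: sT => //.
exists x; rewrite yE (_ : z = 0) ?addr0 //.
have piz : pi z = 0 by move: piy0; rewrite yE (linD pi_lin) pi_iota add0r.
apply: (triangular_separation Tz) => l bl.
have [phi [linphi phiE]] := free_rep_detected free1 bl.
have [phil ld] := basis_detector p_gt0 bl phiE.
have piw w : pi (word_act a w v0) = word_act a w v1 by rewrite hom_word_act // pi_v.
exists (fun x => phi (pi x)); split.
- by move=> c x1 x2; rewrite pi_lin linphi.
- by rewrite piw.
- by move=> w _; rewrite piw => /ld[].
by rewrite piz (lin0 linphi).
Qed.

Variables (C D S E : K).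

Lemma iota_bidegree cd x :
  vm_bidegree a vp C D (S + C) (E + m%:Z%:~R + D) cd x ->
  vm_bidegree a v0 C D S E cd (iota x).
Proof.
move=> Gx; apply: (Gx (fun x => vm_bidegree a v0 C D S E cd (iota x))).
  exact: subspace_preim iota_lin (spanned_subspace _).
move=> _ [ns [-> cd1 cd2]]; apply: spanned_gen; exists (rcons ns m.+1%:Z); split.
- rewrite -/(mode_word a ns vp) hom_mode_word // iota_v.
  by rewrite -cats1 foldr_cat.
- by rewrite cd1 size_rcons -[(size ns).+1]addn1 natrD; ring.
rewrite cd2 size_rcons -[(size ns).+1]addn1 natrD -cats1 big_cat big_seq1 /= !intrD.
by ring.
Qed.

Lemma pi_bidegree cd x :
  vm_bidegree a v0 C D S E cd x -> vm_bidegree a v1 C D S E cd (pi x).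
Proof.
move=> Gx; apply: (Gx (fun x => vm_bidegree a v1 C D S E cd (pi x))).
  exact: subspace_preim pi_lin (spanned_subspace _).
move=> _ [ns [-> cd1 cd2]]; apply: spanned_gen; exists ns; split=> //.
by rewrite -/(mode_word a ns v0) hom_mode_word // pi_v.
Qed.

End ExactSequence.

Lemma free_rep_bigraded (m : nat) (M : vmodule Fk) (v : M) (C D S E : K) :
  is_free_rep a m%:Z v ->
  is_bigraded_vm (va_bidegree a C D) (vm_bidegree a v C D S E).
Proof.
move=> freeM; have [[_ ordM genM] _] := freeM.
apply: (bidegree_bigraded charK a_par a_prod a_top a_gen) genM => //.
  by apply/order_vector; exact: ordM.
exact: free_rep_detected freeM.
Qed.

Lemma quotient_va_bigraded (C D : K) : is_bigraded_va (va_bidegree a C D).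
Proof.
split; first by apply: spanned_gen; exists [::]; rewrite big_nil /=; split=> //; ring.
exact: (bidegree_bigraded charK a_par a_prod a_top a_gen (M := adjoint_module Fk)
  _ _ _ _ _ p_gt0 vacuum_detected adjoint_vacuum_generated).
Qed.

End FreeRepresentations.

(* For m < 0 one has a_(-m-1) = 0 on every module over F(k,p), so that the map
   iota is zero while M_k(m+p) is not: the claim only holds for 0 <= m. *)
Theorem proposition5 (R : realType) (p : nat) (k m : int) (C D S E : R[i])
    (F : vertexAlg R[i]) (aF : F)
    (Fk : vertexAlg R[i]) (q : F -> Fk)
    (M0 M1 Mp : vmodule Fk) (v0 : M0) (v1 : M1) (vp : Mp) :
  let a : Fk := q aF in
  (0 < p)%N -> C != 0 -> 0 <= m -> m + 2 <= k ->
  is_free_va p aF ->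
  is_quotient_va k aF q ->
  is_free_rep a m v0 ->
  is_free_rep a (m + 1) v1 ->
  is_free_rep a (m + p%:Z) vp ->
  exists (iota : Mp -> M0) (pi : M0 -> M1),
    [/\ unique_vm_hom vp (vm_act M0 a (- m - 1) v0) iota,
        unique_vm_hom v0 v1 pi
      & short_exact iota pi]
    /\
    (let G := va_bidegree a C D in
     let G0 := vm_bidegree a v0 C D S E in
     let G1 := vm_bidegree a v1 C D S E in
     let Gp := vm_bidegree a vp C D (S + C) (E + m%:~R + D) in
     [/\ is_bigraded_va G,
         [/\ is_bigraded_vm G G0, is_bigraded_vm G G1 & is_bigraded_vm G Gp],
         forall (cd : R[i] * R[i]) (x : Mp), Gp cd x -> G0 cd (iota x)
       & forall (cd : R[i] * R[i]) (x : M0), G0 cd x -> G1 cd (pi x)]).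
Proof.
have charK : [pchar R[i]] =i pred0 by exact: pchar_num.
move=> a p_gt0 _; case: m => // m _.
case: k => [[|N]|k] mk freeF quoF free0 free1 freep; [lia | | lia].
have mN : (m < N)%N by lia.
have {}free1 : is_free_rep a m.+1%:Z v1 by rewrite -addn1 PoszD.
have bigraded := free_rep_bigraded charK p_gt0 freeF quoF.
have [pi [pi_hom pi_surj]] := projection_exists charK p_gt0 freeF quoF free0 free1.
have [iota iota_hom] := inclusion_exists charK p_gt0 freeF quoF mN free0 freep.
exists iota, pi; rewrite (_ : - m%:Z - 1 = Negz m); last by lia.
split; last first.
  move=> G G0 G1 Gp; split.
  - exact (quotient_va_bigraded charK p_gt0 freeF quoF C D).
  - by split; [exact: bigraded free0 | exact: bigraded free1 | exact: bigraded freep].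
  - by move=> cd x Gx; exact (iota_bidegree iota_hom Gx).
  by move=> cd x Gx; exact (pi_bidegree pi_hom Gx).
split; [exact: iota_hom | exact: pi_hom | split; last exact: pi_surj].
  exact (iota_injective charK p_gt0 freeF quoF mN free0 freep iota_hom).
move=> y; split=> [y0|[x <-]].
  exact (kernel_pi charK p_gt0 freeF quoF mN free0 free1 freep iota_hom pi_hom y0).
exact (pi_iota charK p_gt0 freeF quoF free1 freep iota_hom pi_hom x).
Qed.
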